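(* Let $\Omega\subset\mathbb{R}^d$ ($d\in\{2,3\}$), the coefficient $\mathbf{A}$ (with bounds $\alpha,\beta$), the source $f$, the meshes $\mathcal{T}_h,\mathcal{T}_H$, the ideal multiscale space $V^{\mathrm{ms}}_{H,h}$ and the constant $\gamma>0$ be as described in the context. Then the ideal multiscale problem: find $\mathbf{u}^{\mathrm{ms}}_{H,h}\in V^{\mathrm{ms}}_{H,h}$ and $p_H\in Q_H$ such that $$a(\mathbf{u}^{\mathrm{ms}}_{H,h},\mathbf{v}_h)+b(\mathbf{v}_h,p_H)=0,\qquad b(\mathbf{u}^{\mathrm{ms}}_{H,h},q_H)=-(f,q_H)\qquad\text{for all }\mathbf{v}_h\in V^{\mathrm{ms}}_{H,h},\ q_H\in Q_H,$$ has a unique solution. In particular, $$\gamma\,(1+\alpha^{-1}\beta)^{-1}\;\le\;\inf_{q\in Q_H}\ \sup_{\mathbf{v}\in V^{\mathrm{ms}}_{H,h}}\frac{b(\mathbf{v},q)}{\|q\|_Q\,\|\mathbf{v}\|_V}$$ (infimum and supremum over nonzero elements), i.e. inf-sup stability holds with a constant independent of $h$ and $H$.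
   Context: **Domain and data.** $d\in\{2,3\}$; $\Omega\subset\mathbb{R}^d$ is a bounded Lipschitz domain with polygonal (or polyhedral) boundary and outer normal $\mathbf{n}$. $\mathbf{A}\in[L^\infty(\Omega)]^{d\times d}$ is a.e. symmetric and there are real numbers $0<\alpha\le\beta<\infty$ with $\alpha\le \frac{(\mathbf{A}(x)^{-1}\mathbf{v})\cdot\mathbf{v}}{\mathbf{v}\cdot\mathbf{v}}\le\beta$ for a.e. $x\in\Omega$ and all $\mathbf{v}\in\mathbb{R}^d\setminus\{0\}$. The source satisfies $f\in L^2(\Omega)$, $\int_\Omega f=0$. **Forms and norms.** $(\cdot,\cdot)_\omega$ is the $L^2(\omega)$ scalar product (scalar or vector valued), $(\cdot,\cdot)=(\cdot,\cdot)_\Omega$. $V=H_0(\mathrm{div},\Omega)=\{\mathbf{v}\in[L^2(\Omega)]^d:\nabla\cdot\mathbf{v}\in L^2(\Omega),\ \mathbf{v}\cdot\mathbf{n}|_{\partial\Omega}=0\}$ with $\|\mathbf{v}\|_V^2=\|\mathbf{v}\|_{L^2(\Omega)}^2+\|\nabla\cdot\mathbf{v}\|_{L^2(\Omega)}^2$; $Q=\{q\in L^2(\Omega):\int_\Omega q=0\}$ with $\|q\|_Q=\|q\|_{L^2(\Omega)}$; $a(\mathbf{u},\mathbf{v})=(\mathbf{A}^{-1}\mathbf{u},\mathbf{v})$, $b(\mathbf{v},q)=(\nabla\cdot\mathbf{v},q)$. **Meshes.** $\{\mathcal{T}_h\}$ (fine) and $\{\mathcal{T}_H\}$ (coarse)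 are families of conforming simplicial meshes of $\Omega$; $h$ and $H$ are the maximum element diameters. Each $\mathcal{T}_h$ is obtained from $\mathcal{T}_H$ by one or more conforming (possibly non-uniform) refinements such that $\mathcal{T}_h\cap\mathcal{T}_H=\emptyset$. Both families are shape regular, and the coarse family is quasi-uniform (the fine meshes may be adaptively refined). **Spaces.** $V_h\subset V$ and $V_H\subset V$ are the lowest-order Raviart–Thomas spaces: functions in $V$ whose restriction to each element of $\mathcal{T}_h$ (resp. $\mathcal{T}_H$) lies in $[\mathbb{P}^0]^d+x\,\mathbb{P}^0$. $Q_h,Q_H\subset Q$ are the mean-zero piecewise constants on $\mathcal{T}_h,\mathcal{T}_H$. With $W=H_0(\mathrm{div},\Omega)\cap [L^s(\Omega)]^d$ for some fixed $s>2$ (with its natural norm $\|\cdot\|_W$, the $L^s$-norm plus the $L^2$-norm of the divergence), $\Pi_h:W\to V_h$ and $\Pi_H:W\to V_H$ are the nodal Raviart–Thomas interpolation operators, determined by preserving the average normal flux $\frac1{|e|}\int_e\mathbf{v}\cdot\mathbf{n}_e$ over each fine (resp. coarse) edge/face. $K_h^{\mathrm f}=\{\mathbf{v}\in V_h:\nabla\cdot\mathbf{v}=0,\ \Pi_H\mathbf{v}=0\}$. **Ideal correctors and space.** For $T\in\mathcal{T}_H$, $G^T_h:V\to K_h^{\mathrm f}$ is defined by $a(G^T_h\mathbf{v},\mathbf{v}^{\mathrm f})=(\mathbf{A}^{-1}\mathbf{v},\mathbf{v}^{\mathrm f})_T$ for all $\mathbf{v}^{\mathrm f}\in K_h^{\mathrm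 f}$. $G_h=\sum_{T\in\mathcal{T}_H}G^T_h$ and $V^{\mathrm{ms}}_{H,h}=(\mathrm{Id}-G_h)(V_H)$. **The constant $\gamma$.** $\gamma:=C_W^{-1}C_\Omega^{-1}$, where $C_W$ is a constant independent of the mesh sizes with $\|\Pi_h\mathbf{v}\|_V\le C_W\|\mathbf{v}\|_W$ and $\|\Pi_H\mathbf{v}\|_V\le C_W\|\mathbf{v}\|_W$ for all $\mathbf{v}\in W$, and $C_\Omega$ is a constant such that for each $q\in Q$ there is $\mathbf{w}\in W$ with $\nabla\cdot\mathbf{w}=q$ and $\|\mathbf{w}\|_W\le C_\Omega\|q\|_{L^2(\Omega)}$. This $\gamma$, independent of $h$ and $H$, is an inf-sup constant of $b$ on both pairs $(V_h,Q_h)$ and $(V_H,Q_H)$, i.e. $\inf_{q\in Q_H}\sup_{\mathbf{v}\in V_H}\frac{b(\mathbf{v},q)}{\|q\|_Q\|\mathbf{v}\|_V}\ge\gamma$ and likewise for $(V_h,Q_h)$. *)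

(* Defs.v *)
From HB Require Import structures.
From mathcomp Require Import all_boot all_order all_algebra finmap.
From mathcomp Require Import all_classical all_reals all_analysis.
Set Implicit Arguments.
Unset Strict Implicit.
Unset Printing Implicit Defensive.
Import Order.TTheory GRing.Theory Num.Theory.
Import numFieldNormedType.Exports.
Local Open Scope classical_set_scope.
Local Open Scope ring_scope.

(* Borel sigma-algebra of R^n (generated by the coordinates) and n-dimensional
   Lebesgue measure, built as an iterated product measure; the library provides
   neither for row vectors. *)
Definition rV_display : measure_display.
Proof. by constructor. Qed.

Section measurable_rV.
Context {R : realType} {n : nat}.

Let coord (i : 'I_n) (x : 'rV[R]_n) : measurableTypeR R := x ord0 i.

Let rV_set0 : g_sigma_preimage coord set0.
Proof. exact: sigma_algebra0. Qed.

Let rV_setC B : g_sigma_preimage coord B -> g_sigma_preimage coord (~` B).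
Proof. exact: sigma_algebraC. Qed.

Let rV_bigcup (F : (set 'rV[R]_n)^nat) :
  (forall i, g_sigma_preimage coord (F i)) ->
  g_sigma_preimage coord (\bigcup_i F i).
Proof. exact: sigma_algebra_bigcup. Qed.

HB.instance Definition _ := @isMeasurable.Build rV_display
  'rV[R]_n (g_sigma_preimage coord) rV_set0 rV_setC rV_bigcup.

Lemma measurable_coord (i : 'I_n) :
  measurable_fun [set: 'rV[R]_n] (fun x : 'rV[R]_n => x ord0 i : measurableTypeR R).
Proof.
move=> _ Y mY; rewrite setTI; apply: sub_sigma_algebra => /=.
rewrite -bigcup_seq/=; exists i => /=; first by rewrite mem_index_enum.
by exists Y => //; rewrite setTI.
Qed.

Lemma measurable_fun_rVP d (T : measurableType d) (f : T -> 'rV[R]_n) :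
  measurable_fun [set: T] f <->
  forall i, measurable_fun [set: T] (fun t => f t ord0 i : measurableTypeR R).
Proof.
split=> [mf i|mf].
  exact: (measurableT_comp (measurable_coord i) mf).
move=> _ Y mY; rewrite setTI.
suff: g_sigma_preimage coord `<=` [set Y | measurable (f @^-1` Y)].
  by apply.
apply: smallest_sub => //.
  split => /=.
  - by rewrite preimage_set0.
  - by move=> B mB; rewrite setTD preimage_setC; apply: measurableC.
  - by move=> F mF; rewrite preimage_bigcup; apply: bigcup_measurable.
move=> B; rewrite -bigcup_seq => -[i _ [C mC <-]] /=.
rewrite setTI.
by have := mf i measurableT C mC; rewrite setTI.
Qed.

End measurable_rV.

Section lebesgue_rV.
Context {R : realType}.

Definition rV_cons n (p : measurableTypeR R * 'rV[R]_n) : 'rV[R]_n.+1 :=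
  row_mx (const_mx p.1 : 'rV_1) p.2.

Lemma measurable_rV_cons n : measurable_fun [set: _] (@rV_cons n).
Proof.
apply/measurable_fun_rVP => i.
have [j ->|j ->] := @split_ordP 1 n i.
  rewrite [X in measurable_fun _ X](_ : _ = fst) //.
  by apply/funext => p; rewrite /rV_cons (@row_mxEl _ 1 1 n) mxE.
rewrite [X in measurable_fun _ X](_ : _ = (fun x : 'rV[R]_n => x ord0 j) \o snd).
  exact: (measurableT_comp (measurable_coord j) measurable_snd).
by apply/funext => p; rewrite /rV_cons (@row_mxEr _ 1 1 n).
Qed.

Definition rV_uncons n (x : 'rV[R]_n.+1) : measurableTypeR R * 'rV[R]_n :=
  (x ord0 ord0, @rsubmx R 1 1 n x).

Lemma measurable_rV_uncons n : measurable_fun [set: _] (@rV_uncons n).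
Proof.
apply/measurable_fun_pairP; split; first exact: measurable_coord.
apply/measurable_fun_rVP => i.
rewrite [X in measurable_fun _ X](_ : _ =
  (fun x : 'rV[R]_n.+1 => x ord0 (@rshift 1 n i))).
  exact: measurable_coord.
by apply/funext => x; rewrite /= mxE.
Qed.

Lemma rV_consK n : cancel (@rV_cons n) (@rV_uncons n).
Proof.
move=> [t x]; rewrite /rV_uncons /rV_cons row_mxKr; congr pair.
have -> : ord0 = lshift n (ord0 : 'I_1) by exact/val_inj.
by rewrite (@row_mxEl _ 1 1 n) mxE.
Qed.

Section step.
Context (n : nat) (mu : {sigma_finite_measure set 'rV[R]_n -> \bar R}).

Definition lebesgue_rV_step : set 'rV[R]_n.+1 -> \bar R :=
  pushforward ((@lebesgue_measure R) \x mu)%E (@rV_cons n).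

Let step0 : lebesgue_rV_step set0 = 0%E.
Proof. by rewrite /lebesgue_rV_step /pushforward preimage_set0 measure0. Qed.

Let step_ge0 A : (0 <= lebesgue_rV_step A)%E.
Proof. by rewrite /lebesgue_rV_step /pushforward measure_ge0. Qed.

Let step_sigma_additive : semi_sigma_additive lebesgue_rV_step.
Proof.
exact: (@measure_semi_sigma_additive _ _ _
  (measure_function_pushforward__canonical__measure_function_Measure
    ((@lebesgue_measure R) \x mu)%E (@measurable_rV_cons n))).
Qed.

HB.instance Definition _ := isMeasure.Build _ _ _ lebesgue_rV_step
  step0 step_ge0 step_sigma_additive.

Let step_sigma_finite : sigma_finite [set: 'rV[R]_n.+1] lebesgue_rV_step.
Proof.
have /sigma_finiteP[F [TF ndF mF]] := sigma_finiteT (@lebesgue_measure R).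
have /sigma_finiteP[G [TG ndG mG]] := sigma_finiteT mu.
have rV_consP k : @rV_cons n @^-1` (@rV_uncons n @^-1` (F k `*` G k)) = F k `*` G k.
  rewrite -comp_preimage (_ : _ \o _ = id) ?preimage_id//.
  by apply/funext => p /=; exact: rV_consK.
exists (fun k => @rV_uncons n @^-1` (F k `*` G k)).
  apply/esym/seteqP; split => // x _.
  have : [set: _] (rV_uncons x).1 by [].
  have : [set: _] (rV_uncons x).2 by [].
  rewrite TF TG => -[k _ Gk] [l _ Fl]; exists (maxn k l) => //; split.
    by move: Fl; exact/subsetPset/ndF/leq_maxr.
  by move: Gk; exact/subsetPset/ndG/leq_maxl.
move=> k; have [mFk Fk] := mF k; have [mGk Gk] := mG k; split.
  have := @measurable_rV_uncons n measurableT _ (measurableX mFk mGk).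
  by rewrite setTI.
rewrite /lebesgue_rV_step /pushforward rV_consP product_measure1E//.
by rewrite lte_mul_pinfty// ge0_fin_numE.
Qed.

HB.instance Definition _ := Measure_isSigmaFinite.Build _ _ _ lebesgue_rV_step
  step_sigma_finite.

End step.

Fixpoint lebesgue_rV (n : nat) : {sigma_finite_measure set 'rV[R]_n -> \bar R} :=
  if n is m.+1 then lebesgue_rV_step (lebesgue_rV m)
  else \d_(0 : 'rV[R]_0).

End lebesgue_rV.

Section euclidean_calculus.
Context {R : realType} {d : nat}.
Local Notation E := 'rV[R]_d.
Local Notation leb := (lebesgue_rV d).

Definition dotv (u v : E) : R := \sum_(i < d) u ord0 i * v ord0 i.

(* The library norm of 'rV[R]_d is the sup norm. *)
Definition enorm (u : E) : R := Num.sqrt (dotv u u).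

Definition ae_on (D : set E) (P : E -> Prop) : Prop :=
  {ae leb, forall x, D x -> P x}.

Definition partial (i : 'I_d) (phi : E -> R) : E -> R :=
  fun x => 'D_(delta_mx ord0 i) phi x.

Definition grad (phi : E -> R) : E -> E := fun x => \row_i partial i phi x.

(* Class C^oo: every iterated partial derivative exists and is continuous. *)
Definition smooth (phi : E -> R) : Prop :=
  forall l : seq 'I_d, continuous (foldr partial phi l) /\
    forall i x, derivable (foldr partial phi l) x (delta_mx ord0 i).

Definition test_fun (D : set E) : set (E -> R) :=
  [set phi | smooth phi /\
    exists K : set E, [/\ compact K, K `<=` D & forall x, ~ K x -> phi x = 0]].

Definition inLp (D : set E) (p : \bar R) : set (E -> R) :=
  [set f | f \_ D \in Lfun leb p].

Definition inLpv (D : set E) (p : \bar R) : set (E -> E) :=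
  [set v | forall i, inLp D p (fun x => v x ord0 i)].

Definition ipL2 (D : set E) (f g : E -> R) : R :=
  \int[leb]_(x in D) (f x * g x).

Definition ipL2v (D : set E) (u v : E -> E) : R :=
  \int[leb]_(x in D) (dotv (u x) (v x)).

Definition normL2 (D : set E) (f : E -> R) : R := Num.sqrt (ipL2 D f f).

Definition normL2v (D : set E) (v : E -> E) : R := Num.sqrt (ipL2v D v v).

Definition normLpv (D : set E) (p : R) (v : E -> E) : R :=
  fine ('N[leb]_(p%:E)[EFin \o ((fun x => enorm (v x)) \_ D)]).

Definition inH1 (D : set E) (phi : E -> R) (g : E -> E) : Prop :=
  [/\ inLp D 2%:E phi, inLpv D 2%:E g &
    forall psi, test_fun D psi -> forall i,
      ipL2 D phi (partial i psi) = - ipL2 D (fun x => g x ord0 i) psi].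

Definition is_div (D : set E) (v : E -> E) : set (E -> R) :=
  [set g | inLp D 2%:E g /\
    forall psi, test_fun D psi -> ipL2v D v (grad psi) = - ipL2 D g psi].

Definition Hdiv (D : set E) : set (E -> E) :=
  [set v | inLpv D 2%:E v /\ exists g, is_div D v g].

(* A representative of the weak divergence, which is unique up to null sets. *)
Definition div (D : set E) (v : E -> E) : E -> R := xget (fun=> 0) (is_div D v).

(* The normal trace of v in H(div) is the functional
   phi |-> (v, grad phi) + (div v, phi) on H^1. *)
Definition H0div (D : set E) : set (E -> E) :=
  [set v | Hdiv D v /\
    forall phi g, inH1 D phi g -> ipL2v D v g + ipL2 D (div D v) phi = 0].

Definition normV (D : set E) (v : E -> E) : R :=
  Num.sqrt (normL2v D v ^+ 2 + normL2 D (div D v) ^+ 2).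

Definition spaceQ (D : set E) : set (E -> R) :=
  [set q | inLp D 2%:E q /\ \int[leb]_(x in D) q x = 0].

Definition spaceW (D : set E) (s : R) : set (E -> E) :=
  [set v | H0div D v /\ inLpv D s%:E v].

Definition normW (D : set E) (s : R) (v : E -> E) : R :=
  normLpv D s v + normL2 D (div D v).

(* Vectors are rows, so the product of a matrix M with u is u *m M^T. *)
Definition mxact (M : 'M[R]_d) (u : E) : E := u *m M^T.

Definition admissible_coef (D : set E) (A : E -> 'M[R]_d) (alpha beta : R) :
    Prop :=
  [/\ forall i j, inLp D +oo%E (fun x => A x i j),
      ae_on D (fun x => (A x)^T = A x),
      0 < alpha /\ alpha <= beta &
      ae_on D (fun x => A x \in unitmx /\ forall v : E, v != 0 ->
        alpha <= dotv (mxact (invmx (A x)) v) v / dotv v v <= beta)].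

Definition aform (A : E -> 'M[R]_d) (D : set E) (u v : E -> E) : R :=
  ipL2v D (fun x => mxact (invmx (A x)) (u x)) v.

Definition bform (D : set E) (v : E -> E) (q : E -> R) : R := ipL2 D (div D v) q.

Definition infsup (D : set E) (X : set (E -> E)) (Y : set (E -> R)) : \bar R :=
  ereal_inf [set ereal_sup
      [set (bform D v q / (normL2 D q * normV D v))%:E
        | v in [set v | X v /\ normV D v != 0]]
    | q in [set q | Y q /\ normL2 D q != 0]].

(* Near each boundary point, D is the strict epigraph, in the direction nu, of a
   Lipschitz function of the component orthogonal to nu. *)
Definition lipschitz_boundary (D : set E) : Prop :=
  forall x, (closure D `\` D) x ->
  exists (nu : E) (r L : R) (zeta : E -> R),
    [/\ enorm nu = 1, 0 < r,
        forall y z, `|zeta y - zeta z| <= L * enorm (y - z) &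
        forall y, enorm (y - x) < r ->
          (D y <-> zeta (y - dotv y nu *: nu) < dotv y nu)].

Definition polyhedral_boundary (D : set E) : Prop :=
  exists F : seq (E * R), (forall h, h \in F -> h.1 != 0) /\
    forall x, (closure D `\` D) x -> exists2 h, h \in F & dotv h.1 x = h.2.

Definition polyhedral_lipschitz_domain (D : set E) : Prop :=
  [/\ open D, connected D, D !=set0, bounded_set D &
      lipschitz_boundary D /\ polyhedral_boundary D].

End euclidean_calculus.

(* A simplex is given by its finite set of vertices. *)
Section meshes.
Context {R : realType} {d : nat}.
Local Notation E := 'rV[R]_d.
Local Notation mesh := {fset {fset E}}.

Definition conv (t : {fset E}) : set E :=
  [set x | exists lam : E -> R,
    [/\ forall p, 0 <= lam p, \sum_(p <- t) lam p = 1 &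
        x = \sum_(p <- t) lam p *: p]].

Definition affine_indep (t : {fset E}) : Prop :=
  forall mu : E -> R, \sum_(p <- t) mu p = 0 -> \sum_(p <- t) mu p *: p = 0 ->
    forall p, p \in t -> mu p = 0.

Definition is_simplex (t : {fset E}) : Prop := #|` t|%fset = d.+1 /\ affine_indep t.

Definition facet (t e : {fset E}) : Prop := (e `<=` t)%fset /\ #|` e|%fset = d.

Definition rel_boundary (e : {fset E}) : set E :=
  [set x | exists2 p, p \in e & conv (e `\ p)%fset x].

Definition conforming_mesh (D : set E) (M : mesh) : Prop :=
  [/\ forall t, t \in M -> is_simplex t,
      forall t t', t \in M -> t' \in M ->
        conv t `&` conv t' = conv (t `&` t')%fset &
      closure D = [set x | exists2 t, t \in M & conv t x]].

Definition refinement (D : set E) (M M' : mesh) : Prop :=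
  conforming_mesh D M' /\
  forall t', t' \in M' -> exists2 t, t \in M & conv t' `<=` conv t.

Definition diam (B : set E) : R :=
  sup [set r | exists x y, [/\ B x, B y & r = enorm (x - y)]].

Definition inradius (B : set E) : R :=
  sup [set r | 0 <= r /\ exists c, forall y, enorm (y - c) <= r -> B y].

Definition mesh_size (M : mesh) : R := \big[Num.max/0]_(t <- M) diam (conv t).

Definition shape_regular (I : Type) (T : I -> mesh) : Prop :=
  exists2 sigma : R, 0 < sigma & forall i t, t \in T i ->
    diam (conv t) <= sigma * inradius (conv t).

Definition quasi_uniform (I : Type) (T : I -> mesh) : Prop :=
  exists2 c : R, 0 < c & forall i t, t \in T i ->
    c * mesh_size (T i) <= diam (conv t).

Definition RT0 (D : set E) (M : mesh) : set (E -> E) :=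
  [set v | H0div D v /\ forall t, t \in M ->
    exists (a : E) (b : R), ae_on (conv t) (fun x => v x = a + b *: x)].

Definition P0 (D : set E) (M : mesh) : set (E -> R) :=
  [set q | spaceQ D q /\ forall t, t \in M ->
    exists c : R, ae_on (conv t) (fun x => q x = c)].

(* (d-1)-dimensional measure of the simplex with vertex set e, from the Gram
   determinant of its edge vectors. *)
Definition facet_area (e : {fset E}) : R :=
  let p k := nth 0 (enum_fset e) k in
  Num.sqrt (\det (\matrix_(i < d.-1, j < d.-1)
    dotv (p i.+1 - p 0%N) (p j.+1 - p 0%N))) / (d.-1)`!%:R.

(* A W^{1,p} function on t whose trace is 1 on the facet e and 0 on the other
   facets; it cannot be continuous on the relative boundary of e. *)
Record facet_lift (p : R) (t e : {fset E}) (phi : E -> R) : Prop := FacetLift {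
  facet_lift_L2 : inLp (interior (conv t)) 2%:E phi;
  facet_lift_C1 : forall i x, interior (conv t) x ->
    derivable phi x (delta_mx ord0 i) /\ {for x, continuous (partial i phi)};
  facet_lift_grad : inLpv (interior (conv t)) p%:E (grad phi);
  facet_lift_continuous :
    {within conv t `\` rel_boundary e, continuous phi};
  facet_lift_1 : forall x, conv e x -> ~ rel_boundary e x -> phi x = 1;
  facet_lift_0 : forall e' x, facet t e' -> e' != e -> conv e' x ->
    ~ rel_boundary e x -> phi x = 0 }.

(* For v in H(div) with v in L^s, s > 2, the normal component on a single facet
   e of t (outward from t) is defined by duality: its integral over e is
   (v, grad phi)_t + (div v, phi)_t for any lift phi of the indicator function
   of e with exponent s / (s - 1), by Green's formula. *)
Definition avg_normal_flux (D : set E) (t e : {fset E}) (phi : E -> R)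
    (v : E -> E) : R :=
  (facet_area e)^-1 *
  (ipL2v (interior (conv t)) v (grad phi) +
   ipL2 (interior (conv t)) (div D v) phi).

(* Functions are representatives of almost-everywhere classes; linearity
   includes compatibility with almost-everywhere equality. *)
Definition RT_interpolation (D : set E) (s : R) (M : mesh)
    (Pi : (E -> E) -> (E -> E)) : Prop :=
  [/\ forall v, spaceW D s v -> RT0 D M (Pi v),
      forall (c : R) v w u, spaceW D s v -> spaceW D s w -> spaceW D s u ->
        ae_on D (fun x => u x = c *: v x + w x) ->
        ae_on D (fun x => Pi u x = c *: Pi v x + Pi w x) &
      forall v t e phi, spaceW D s v -> t \in M -> facet t e ->
        facet_lift (s / (s - 1)) t e phi ->
        avg_normal_flux D t e phi (Pi v) = avg_normal_flux D t e phi v].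

(* The fine-scale divergence-free space K_h^f. *)
Definition Kfine (D : set E) (Th : mesh) (PiH : (E -> E) -> (E -> E)) :
    set (E -> E) :=
  [set v | [/\ RT0 D Th v, ae_on D (fun x => div D v x = 0) &
    ae_on D (fun x => PiH v x = 0)]].

Definition ideal_corrector (D : set E) (A : E -> 'M[R]_d) (K : set (E -> E))
    (T : {fset E}) (G : (E -> E) -> (E -> E)) : Prop :=
  forall v, H0div D v ->
    K (G v) /\ forall w, K w -> aform A D (G v) w = aform A (conv T) v w.

Definition ideal_ms_space (D : set E) (TH : mesh)
    (G : {fset E} -> (E -> E) -> (E -> E)) : set (E -> E) :=
  [set u | H0div D u /\ exists2 v, RT0 D TH v &
    ae_on D (fun x => u x = v x - \sum_(T <- TH) G T v x)].

Definition ideal_ms_solution (D : set E) (A : E -> 'M[R]_d) (f : E -> R)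
    (X : set (E -> E)) (Y : set (E -> R)) (u : E -> E) (p : E -> R) : Prop :=
  [/\ X u, Y p,
      forall v, X v -> aform A D u v + bform D v p = 0 &
      forall q, Y q -> bform D u q = - ipL2 D f q].

End meshes.

(* Main.v *)
Require Import Defs.
From mathcomp Require Import all_boot all_order all_algebra finmap.
From mathcomp Require Import all_classical all_reals all_analysis.
From mathcomp Require Import measurable_realfun.
From mathcomp Require Import ring lra.
From Stdlib Require Import Relation_Operators.
Set Implicit Arguments.
Unset Strict Implicit.
Unset Printing Implicit Defensive.
Import Order.TTheory GRing.Theory Num.Theory.
Import numFieldNormedType.Exports.
Local Open Scope classical_set_scope.
Local Open Scope ring_scope.

(** Let [Gv] be the sum over the coarse simplices [T] of the correctors [G T v],
    and let [ms v = v - Gv]. Adding up the local problems shows that [Gv] is the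
    [a]-orthogonal projection of [v] on the divergence-free fine-scale fields, so
    that [a(ms v, ms v) <= a(v, v)] by Pythagoras. As [a] lies between [alpha] and
    [beta] times the squared L2 norm, [ms] enlarges the L2 norm by at most
    [sqrt (beta / alpha) <= 1 + beta / alpha], and it leaves the divergence
    unchanged. Hence [b(ms v, q) = b(v, q)] while the norm of [ms v] is at most
    [1 + beta / alpha] times that of [v]: the inf-sup constant of the coarse
    Raviart-Thomas pair survives up to this factor ([infsup_ms]).

    For the saddle point problem, the difference [(u, p)] of two solutions solves
    the homogeneous problem; testing with [u] gives [a(u, u) = 0], so [u = 0]
    almost everywhere, and then the inf-sup condition gives [p = 0]
    ([ms_homogeneous]). Modulo null sets the multiscale space and the piecewise
    constants are finite-dimensional, so existence follows from uniqueness by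
    linear algebra ([saddle_point_solvable]).

    Behind these few lines stands some analysis. Fields are functions and not
    almost-everywhere classes, and their divergence is a chosen representative of
    the weak divergence. That [b] is linear in its first argument therefore rests
    on the uniqueness of weak divergences, that is, on the fundamental lemma of
    the calculus of variations ([fundamental_lemma_calculus_variations]); its
    proof needs smooth bumps, which are products of translates of [exp (- e / y)].
    Adding up local problems requires that integrals over the simplices of a mesh
    add up to the integral over the domain ([sum_Rintegral_mesh]): simplices
    overlap in hulls of at most [d] points, and the boundary of the domain lies in
    finitely many hyperplanes, all of which are null sets ([hyperplane_null]). *)

(** * Borel sets and null sets of row vectors *)

Section borel.
Context {R : realType} {d : nat}.
Local Notation E := 'rV[R]_d.

Definition obox (a b : E) : set E :=
  [set x | forall i, a ord0 i < x ord0 i < b ord0 i].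

Lemma measurable_obox a b : measurable (obox a b).
Proof.
have -> : obox a b = \bigcap_(i in [set: 'I_d])
    ((fun x : E => x ord0 i : measurableTypeR R) @^-1` `]a ord0 i, b ord0 i[%classic).
  apply/seteqP; split => x /=.
    by move=> h i _ /=; rewrite in_itv/= h.
  by move=> h i; have := h i I; rewrite /= in_itv/=.
apply: fin_bigcap_measurable; first exact: finite_finset.
move=> i _; rewrite -[X in measurable X]setTI.
by apply: measurable_coord => //; exact: measurable_itv.
Qed.

Lemma obox_ball (x : E) (r : R) : 0 < r ->
  ball x r = obox (x - const_mx r) (x + const_mx r).
Proof.
move=> r0; apply/seteqP; split => y /=.
  move=> h i.
  have [_ {}h] : 0 < r /\ forall i j, ball (x i j) r (y i j) := h.
  by have := h ord0 i; rewrite /ball/= !mxE ltr_distlC.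
move=> h.
suff: 0 < r /\ forall i j, ball (x i j) r (y i j) by [].
split=> // i j; rewrite ord1; have := h j.
by rewrite /ball/= !mxE ltr_distlC.
Qed.

Definition cbox (a b : E) : set E :=
  [set x : E | forall i, a ord0 i <= x ord0 i <= b ord0 i].

Definition rat_rV (q : 'rV[rat]_d) : E := map_mx ratr q.

(** Rational boxes form a countable base; asking for the closed box inside [U]
    costs nothing and provides the room needed by compactly supported bumps. *)
Lemma open_bigcup_obox (U : set E) : open U ->
  U = \bigcup_(q in [set q : 'rV[rat]_d * 'rV[rat]_d |
                     cbox (rat_rV q.1) (rat_rV q.2) `<=` U])
        obox (rat_rV q.1) (rat_rV q.2).
Proof.
move=> oU; apply/seteqP; split => x; last first.
  by move=> [q qU qx]; apply: qU => i; have /andP[/ltW -> /ltW ->] := qx i.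
move=> Ux.
have [e /= e0 eU] : exists2 e : R, 0 < e & ball x e `<=` U.
  by apply/nbhs_ballP; exact: open_nbhs_nbhs.
have lo i : exists p : rat, x ord0 i - e < ratr p < x ord0 i.
  have /rat_in_itvoo[p] : x ord0 i - e < x ord0 i by rewrite ltrBlDr ltrDl.
  by rewrite in_itv/=; exists p.
have hi i : exists p : rat, x ord0 i < ratr p < x ord0 i + e.
  have /rat_in_itvoo[p] : x ord0 i < x ord0 i + e by rewrite ltrDl.
  by rewrite in_itv/=; exists p.
have [p pP] := choice lo; have [q qP] := choice hi.
exists (\row_i p i, \row_i q i) => /=; last first.
  by move=> i; rewrite /rat_rV !mxE; have /andP[_ ->] := pP i; have /andP[-> _] := qP i.
move=> y yb; apply: eU; rewrite obox_ball// => i.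
have := yb i; rewrite /rat_rV !mxE => /andP[yl yr].
have /andP[pl _] := pP i; have /andP[_ qr] := qP i.
by rewrite (lt_le_trans pl yl) (le_lt_trans yr qr).
Qed.

Lemma open_measurable_rV (U : set E) : open U -> measurable U.
Proof.
move=> /open_bigcup_obox ->; rewrite bigcup_mkcond.
apply: countable_bigcupT_measurable; first exact: countableP.
by move=> q; case: ifP => _ //; exact: measurable_obox.
Qed.

Lemma continuous_measurable_rV (f : E -> R) : continuous f -> measurable_fun setT f.
Proof.
move=> /continuousP cf; apply: (measurability _ (RGenOpens.measurableE R)) => //.
move=> _ [_ [a [b ->]] <-]; rewrite setTI.
apply: open_measurable_rV; apply: cf; exact: interval_open.
Qed.


Lemma closed_measurable_rV (U : set E) : closed U -> measurable U.
Proof.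
by move=> /closed_openC/open_measurable_rV/measurableC; rewrite setCK.
Qed.

Lemma measurable_dotv (h : E) : measurable_fun setT (dotv h).
Proof.
apply: measurable_sum => i; apply: measurable_funM => //.
exact: measurable_coord.
Qed.

Lemma measurable_hyperplane (h : E) (c : R) : measurable [set x | dotv h x = c].
Proof.
rewrite (_ : [set _ | _] = dotv h @^-1` [set c])//.
by rewrite -[X in measurable X]setTI; apply: measurable_dotv.
Qed.

End borel.

Section lebesgue_rV_null.
Context {R : realType}.

Lemma lebesgue_rVS n (A : set 'rV[R]_n.+1) :
  lebesgue_rV n.+1 A =
  product_measure1 (@lebesgue_measure R) (lebesgue_rV n) (@rV_cons R n @^-1` A).
Proof. by []. Qed.

Lemma dotv_rV_cons n (h : 'rV[R]_n.+1) (t : R) (x : 'rV[R]_n) :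
  dotv h (rV_cons (t, x)) = h ord0 ord0 * t + dotv (@rsubmx R 1 1 n h) x.
Proof.
rewrite /dotv big_ord_recl/=; congr (_ * _ + _).
  by rewrite /rV_cons (_ : ord0 = lshift n (ord0 : 'I_1)) ?(@row_mxEl _ 1 1 n) ?mxE//; exact/val_inj.
apply: eq_bigr => i _.
have -> : lift ord0 i = @rshift 1 n i by exact/val_inj.
by rewrite /rV_cons (@row_mxEr _ 1 1 n) mxE.
Qed.

(** By induction on the dimension: almost every slice of a hyperplane is a
    hyperplane of the smaller space, unless the normal is the first axis, where
    the hyperplane is a product with a one-point factor. *)
Lemma hyperplane_null n (h : 'rV[R]_n) (c : R) : h != 0 ->
  lebesgue_rV n [set x | dotv h x = c] = 0%E.
Proof.
elim: n h c => [h c|n IH h c h0]; first by rewrite thinmx0 eqxx.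
rewrite lebesgue_rVS.
set S := _ @^-1` _.
have SE : S = [set p : R * 'rV[R]_n | h ord0 ord0 * p.1 + dotv (@rsubmx R 1 1 n h) p.2 = c].
  by apply/seteqP; split => -[t x]; rewrite /S /= dotv_rV_cons.
have [r0|r0] := eqVneq (@rsubmx R 1 1 n h) 0; last first.
  rewrite /product_measure1.
  apply: integral0_eq => t _ /=.
  rewrite (_ : xsection S t = [set x | dotv (@rsubmx R 1 1 n h) x = c - h ord0 ord0 * t]).
    by rewrite IH.
  apply/seteqP; split => x; rewrite /xsection/= SE inE/=.
    by move=> <-; rewrite addrAC subrr add0r.
  by move=> ->; rewrite addrC subrK.
have h00 : h ord0 ord0 != 0.
  apply: contra_neq h0 => h00; apply/rowP => i; rewrite mxE.
  have [j ->|j ->] := @split_ordP 1 n i.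
    by rewrite -[RHS]h00; congr (h _ _); apply/val_inj; rewrite ord1.
  by have /rowP/(_ j) := r0; rewrite !mxE.
have -> : S = [set c / h ord0 ord0] `*` setT.
  rewrite SE r0; apply/seteqP; split => -[t x] /=.
    rewrite /dotv big1 ?addr0 => [<-|i _]; last by rewrite mxE mul0r.
    by rewrite mulrAC divff// mul1r.
  move=> [-> _]; rewrite /dotv big1 ?addr0 => [|i _]; last by rewrite mxE mul0r.
  by rewrite mulrCA divff// mulr1.
rewrite product_measure1E; [|exact: measurable_set1|exact: measurableT].
exact: (etrans (congr1 (fun y => y * _)%E (lebesgue_measure_set1 _)) (mul0e _)).
Qed.

Lemma coord_le_norm n (x : 'rV[R]_n) i : `|x ord0 i| <= `|x|.
Proof.
rewrite [leRHS]/Num.norm /= mx_normrE; apply/bigmax_geP; right => /=.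
by exists (ord0, i).
Qed.

Lemma bounded_lebesgue_finite n (D : set 'rV[R]_n) : measurable D -> bounded_set D ->
  (lebesgue_rV n D < +oo)%E.
Proof.
move=> mD /pinfty_ex_gt0[M M0 DM].
suff H : forall n, (lebesgue_rV n (obox (const_mx (- (M + 1))%R) (const_mx (M + 1)%R)) < +oo)%E.
  apply: le_lt_trans (H n); apply: le_measure; rewrite ?inE//.
    exact: measurable_obox.
  move=> x /DM /= xM i; rewrite !mxE -ltr_norml.
  apply: le_lt_trans (_ : M < M + 1); last by rewrite ltrDl.
  exact: le_trans (coord_le_norm _ _) xM.
elim=> {n D mD DM} [|n IH]; first by rewrite /= diracE; case: (_ \in _); exact: ltry.
rewrite lebesgue_rVS.
rewrite (_ : _ @^-1` _ = `]- (M + 1), M + 1[%classic `*`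
   obox (const_mx (- (M + 1))%R) (const_mx (M + 1)%R)).
  rewrite product_measure1E; [|exact: measurable_itv|exact: measurable_obox].
  apply: lte_mul_pinfty => //.
  have fin : lebesgue_measure `]- (M + 1), M + 1[%classic \is a fin_num.
    by rewrite lebesgue_measure_itv; case: ifP.
  exact: fin.
apply/seteqP; split => -[t x] /=.
  move=> h; split.
    have := h (lshift n ord0 : 'I_(1 + n)).
    by rewrite /rV_cons (@row_mxEl _ 1 1 n) !mxE in_itv.
  move=> i; have := h (@rshift 1 n i).
  by rewrite /rV_cons (@row_mxEr _ 1 1 n) !mxE.
move=> [t1 h] i; have [j ->|j ->] := @split_ordP 1 n i.
  by rewrite /rV_cons (@row_mxEl _ 1 1 n) !mxE; move: t1; rewrite in_itv.
by rewrite /rV_cons (@row_mxEr _ 1 1 n) !mxE; have := h j; rewrite !mxE.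
Qed.

End lebesgue_rV_null.

(** * Smooth bump functions *)

Section flat.
Context {R : realType}.

(** Each factor [z] costs an arbitrarily small part of the exponent, so the
    induction on the polynomial runs over all rates [e] at once. *)
Lemma horner_le_expR (q : {poly R}) (e : R) : 0 < e ->
  exists2 C, 0 <= C & forall z, 0 <= z -> `|q.[z]| <= C * expR (e * z).
Proof.
elim/poly_ind: q e => [|q c IH] e e0.
  by exists 0 => // z _; rewrite horner0 normr0 mul0r.
have e20 : 0 < e / 2 by rewrite divr_gt0.
have [C C0 HC] := IH _ e20.
exists (C * (e / 2)^-1 + `|c|).
  by rewrite addr_ge0// mulr_ge0// invr_ge0 ltW.
move=> z z0; rewrite hornerMXaddC (le_trans (ler_normD _ _))// mulrDl lerD//; last first.
  rewrite -[leLHS]mulr1 ler_wpM2l//.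
  apply: le_trans (expR_ge1Dx _); rewrite lerDl mulr_ge0//; exact: ltW.
rewrite normrM (ger0_norm z0).
have -> : e * z = e / 2 * z + e / 2 * z by lra.
rewrite expRD -mulrA mulrCA.
rewrite mulrA -mulrA.
have zz : z <= (e / 2)^-1 * expR (e / 2 * z).
  rewrite ler_pdivlMl//; apply: le_trans (expR_ge1Dx _).
  by rewrite lerDr.
rewrite [leRHS](_ : _ = (C * expR (e / 2 * z)) * ((e / 2)^-1 * expR (e / 2 * z))); last by ring.
by apply: ler_pM => //; exact: HC.
Qed.

(** The functions [p(1/y) exp(-e/y)], extended by 0 to [y <= 0]: the derivative
    of such a function is again one of them, whence smoothness. *)
Definition flat (e : R) (p : {poly R}) (y : R) : R :=
  if 0 < y then p.[y^-1] * expR (- (e * y^-1)) else 0.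

(** In the variable [z = 1/y] the chain rule produces the factor [- z^2]. *)
Definition dflat (e : R) (p : {poly R}) : {poly R} := 'X^2 * (e *: p - p^`()).

(** A quadratic bound makes the difference quotients at 0 vanish. *)
Lemma flat_le_sqr e p : 0 < e ->
  exists2 C, 0 <= C & forall y, `|flat e p y| <= C * y ^+ 2.
Proof.
move=> e0; have [C C0 HC] := horner_le_expR ('X^2 * p) e0.
exists C => // y; rewrite /flat; case: ltP => y0; last first.
  by rewrite normr0 mulr_ge0// sqr_ge0.
have yi : 0 <= y^-1 by rewrite invr_ge0 ltW.
have := HC _ yi; rewrite hornerM hornerXn normrM (ger0_norm (exprn_ge0 _ yi)).
rewrite exprVn ler_pdivrMl ?exprn_gt0// => h.
by rewrite normrM (gtr0_norm (expR_gt0 _)) expRN ler_pdivrMr ?expR_gt0// mulrAC mulrC.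
Qed.

Lemma is_derive_flat e p (y : R) : 0 < e ->
  is_derive y 1 (flat e p) (flat e (dflat e p) y).
Proof.
move=> e0; have [y0|y0|y0] := ltgtP y 0.
- have -> : flat e (dflat e p) y = 0 by rewrite /flat ltNge (ltW y0).
  apply: near_eq_is_derive (is_derive_cst (0 : R) y 1).
  near=> z; rewrite /flat ltNge ltW//=.
  by near: z; exact: lt_nbhsl.
- pose g z : R := p.[z^-1] * expR (- (e * z^-1)).
  apply: (@near_eq_is_derive _ _ _ g).
    near=> z; rewrite /flat ifT//.
    by near: z; exact: lt_nbhsr.
  have yn0 : y != 0 by rewrite gt_eqF.
  have dV : is_derive y 1 (fun z : R => z^-1) (- y ^- 2).
    apply: is_derive_eq; first exact: (is_deriveV (f := id)).
    by rewrite /= /GRing.scale/= mulr1.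
  have d1 : is_derive y 1 (fun z : R => p.[z^-1]) (p^`().[y^-1] * (- y ^- 2)).
    exact: (@is_derive1_comp _ (horner p)).
  have d2 : is_derive y 1 (fun z : R => - (e * z^-1)) (- (e * (- y ^- 2))).
    by apply: is_deriveN; exact: is_deriveZ.
  have d3 : is_derive y 1 (fun z : R => expR (- (e * z^-1)))
     (expR (- (e * y^-1)) * (- (e * (- y ^- 2)))).
    exact: (@is_derive1_comp _ expR).
  apply: is_derive_eq.
  rewrite /flat y0 /dflat !hornerE /GRing.scale/=.
  rewrite -exprVn; move: (p^`().[y^-1]) (p.[y^-1]) (expR (- (e * y^-1))) (y^-1) => A B C w.
  by ring.
- rewrite y0 {y y0}; rewrite {2}/flat ltxx.
  have [C C0 HC] := flat_le_sqr p e0.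
  have key : (fun h : R => h^-1 *: (flat e p (h *: 1 + 0) - flat e p 0)) @ 0^' --> (0 : R).
    apply/cvgrPdist_le => eps eps0.
    near=> h.
    rewrite sub0r normrN addr0 /flat ltxx subr0 -/(flat e p _) normrZ normfV.
    have h0 : h != 0 by near: h; exact: nbhs_dnbhs_neq.
    rewrite ler_pdivrMl ?normr_gt0//.
    apply: (le_trans (HC _)); rewrite [_%:A]mulr1 -real_normK ?num_real// expr2 mulrCA ler_wpM2l//.
    apply: (@le_trans _ _ ((C + 1) * `|h|)); first by rewrite ler_wpM2r// lerDl.
    rewrite mulrC -ler_pdivlMr ?ltr_wpDl//.
    by near: h; apply: dnbhs0_le; rewrite divr_gt0// ltr_wpDl.
  apply: DeriveDef; first by apply/cvg_ex; exists 0; exact: key.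
  exact: cvg_lim key.
Unshelve. all: end_near.
Qed.

End flat.

Section bump.
Context {R : realType} {d : nat}.
Local Notation E := 'rV[R]_d.

(** A class of functions that contains the bumps below and is closed under
    partial derivatives; its members are therefore smooth. *)
Inductive bump_alg (e : R) : (E -> R) -> Prop :=
| bump_cst c : bump_alg e (cst c)
| bump_flat p i s c : bump_alg e (fun x => flat e p (s * x ord0 i + c))
| bump_add f g : bump_alg e f -> bump_alg e g -> bump_alg e (f \+ g)
| bump_mul f g : bump_alg e f -> bump_alg e g -> bump_alg e (f \* g).

Lemma flatZ e p c (y : R) : flat e (c *: p) y = c * flat e p y.
Proof. by rewrite /flat; case: ifP => _; rewrite ?mulr0// hornerZ mulrA. Qed.

Lemma is_derive_along (f : R -> R) (g : E -> R) (x v : E) (df : R) :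
  (forall h : R, g (h *: v + x) = f h) -> is_derive (0 : R) 1 f df ->
  is_derive x v g df.
Proof.
move=> gf [dfc dfE].
have fE : (fun h : R => g (h *: v + x)) = f by exact/funext.
have dg : derivable g x v by apply/derivable1P; rewrite fE.
apply: DeriveDef; first exact: dg.
rewrite -dfE /derive.
suff -> : (fun h : R => h^-1 *: ((g \o shift x) (h *: v) - g x)) =
    (fun h : R => h^-1 *: ((f \o shift 0) (h *: 1) - f 0)) by [].
apply/funext => h /=.
by rewrite -gf -gf scale0r add0r addr0 [_%:A]mulr1.
Qed.

Lemma bump_alg_partial e f : 0 < e -> bump_alg e f -> forall i,
  exists2 g, bump_alg e g & forall x, is_derive x (delta_mx ord0 i) f (g x).
Proof.
move=> e0; elim=> {f} [c|p j s c|f g _ IHf _ IHg|f g bf IHf bg IHg] i.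
- by exists (cst 0); [exact: bump_cst|move=> x; exact: is_derive_cst].
- exists (fun x => flat e ((s * (i == j)%:R) *: dflat e p) (s * x ord0 j + c)).
    exact: bump_flat.
  move=> x; rewrite flatZ.
  apply: (@is_derive_along (fun h => flat e p (h * (s * (i == j)%:R) + (s * x ord0 j + c)))).
    move=> h; rewrite !mxE eqxx/= [j == i]eq_sym; congr (flat _ _ _); ring.
  pose a := s * (i == j)%:R; pose b := s * x ord0 j + c.
  have d1 : is_derive (0 : R) 1 (fun h : R => h * a + b) a.
    have h := is_deriveD (is_deriveM (is_derive_id (0 : R) (1 : R))
      (is_derive_cst a (0 : R) (1 : R))) (is_derive_cst b (0 : R) (1 : R)).
    apply: (is_derive_eq h).
    by rewrite /GRing.scale/= mulr0 mulr1 add0r addr0.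
  apply: is_derive_eq.
    apply: (@is_derive1_comp _ (flat e p) (fun h : R => h * a + b)).
    exact: is_derive_flat.
  by rewrite /= mul0r add0r mulrC.
- have [f' bf' df'] := IHf i; have [g' bg' dg'] := IHg i.
  by exists (f' \+ g'); [exact: bump_add|move=> x; exact: is_deriveD].
- have [f' bf' df'] := IHf i; have [g' bg' dg'] := IHg i.
  exists ((f \* g') \+ (g \* f')).
    by apply: bump_add; exact: bump_mul.
  by move=> x; exact: is_deriveM.
Qed.

Lemma bump_alg_continuous e f : 0 < e -> bump_alg e f -> continuous f.
Proof.
move=> e0; elim=> {f} [c|p j s c|f g _ cf _ cg|f g _ cf _ cg] x.
- exact: cst_continuous.
- apply: (@continuous_comp _ _ _ (fun x : E => x ord0 j)
      (fun t : R => flat e p (s * t + c))); first exact: coord_continuous.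
  apply: differentiable_continuous; apply/derivable1_diffP.
  have h := is_deriveD (is_deriveZ s (is_derive_id (x ord0 j) (1 : R)))
    (is_derive_cst c (x ord0 j) (1 : R)).
  by have [] := @is_derive1_comp _ (flat e p) _ _ _ _ (is_derive_flat p _ e0) h.
- exact: (continuousD (cf x) (cg x)).
- exact: (continuousM (cf x) (cg x)).
Qed.

Lemma bump_alg_smooth e f : 0 < e -> bump_alg e f -> smooth f.
Proof.
move=> e0 bf.
have bl l : bump_alg e (foldr partial f l).
  elim: l => //= i l /bump_alg_partial => /(_ e0 i)[g bg dg].
  rewrite (_ : partial i _ = g)//; apply/funext => x.
  by rewrite /partial; have [_ ->] := dg x.
move=> l; split; first exact: bump_alg_continuous (bl l).
by move=> i x; have [g _ dg] := bump_alg_partial e0 (bl l) i; have [] := dg x.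
Qed.

(** Smooth approximation from below of the indicator of an open box, vanishing
    outside it. *)
Definition box_bump (e : R) (a b x : E) : R :=
  \prod_(i < d) (flat e 1 (1 * x ord0 i + (- a ord0 i)) *
                 flat e 1 ((-1) * x ord0 i + b ord0 i)).

Lemma bump_alg_box e a b : bump_alg e (box_bump e a b).
Proof.
suff : forall s : seq 'I_d, bump_alg e (fun x => \prod_(i <- s) (flat e 1 (1 * x ord0 i + (- a ord0 i)) *
                 flat e 1 ((-1) * x ord0 i + b ord0 i))) by exact.
elim=> [|i s IH].
  rewrite (_ : (fun _ => _) = cst 1); first exact: bump_cst.
  by apply/funext => x; rewrite big_nil.
pose F := fun x : E => flat e 1 (1 * x ord0 i + (- a ord0 i)).
pose G := fun x : E => flat e 1 ((-1) * x ord0 i + b ord0 i).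
have := bump_mul (bump_mul (bump_flat _ _ _ _ _ : bump_alg e F) (bump_flat _ _ _ _ _ : bump_alg e G)) IH.
congr bump_alg; apply/funext => x /=; by rewrite big_cons.
Qed.

Lemma flat1E e (y : R) : 0 < y -> flat e 1 y = expR (- (e * y^-1)).
Proof. by move=> y0; rewrite /flat y0 hornerC mul1r. Qed.

Lemma flat1_itv e (y : R) : 0 <= e -> 0 <= flat e 1 y <= 1.
Proof.
move=> e0; rewrite /flat; case: ltP => y0; last by rewrite lexx ler01.
rewrite hornerC mul1r expR_ge0/= -expR0 ler_expR oppr_le0 mulr_ge0//.
by rewrite invr_ge0 ltW.
Qed.

Lemma box_bump_itv e a b x : 0 <= e -> 0 <= box_bump e a b x <= 1.
Proof.
move=> e0; apply/andP; split.
  apply: prodr_ge0 => i _; apply: mulr_ge0.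
    by have /andP[] := flat1_itv (1 * x ord0 i + - a ord0 i) e0.
  by have /andP[] := flat1_itv (-1 * x ord0 i + b ord0 i) e0.
apply: prodr_ile1 => i _.
have /andP[? ?] := flat1_itv (1 * x ord0 i + - a ord0 i) e0.
have /andP[? ?] := flat1_itv (-1 * x ord0 i + b ord0 i) e0.
by rewrite mulr_ge0//= mulr_ile1.
Qed.

Lemma box_bump_out e a b x : ~ obox a b x -> box_bump e a b x = 0.
Proof.
move=> xab; have [i /negP xi] : exists i, ~ (a ord0 i < x ord0 i < b ord0 i).
  exact/existsNP.
rewrite /box_bump (bigD1 i)//=; apply/eqP; rewrite !mulf_eq0; apply/orP; left.
move: xi; rewrite negb_and -!leNgt => /orP[xi|xi]; apply/orP; [left|right].
  by rewrite /flat ltNge mul1r subr_le0 xi.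
by rewrite /flat ltNge mulN1r addrC subr_le0 xi.
Qed.

(** Every factor [exp (- e / y)], with [y > 0], tends to 1 as [e] tends to 0. *)
Lemma box_bump_in a b x : obox a b x ->
  (fun n => box_bump n.+1%:R^-1 a b x) @ \oo --> (1 : R).
Proof.
move=> xab.
have cv y : 0 < y -> (fun n => flat n.+1%:R^-1 1 y) @ \oo --> (1 : R).
  move=> y0.
  rewrite (_ : (fun n => _) = (fun n => expR (- (n.+1%:R^-1 * y^-1)))); last first.
    by apply/funext => n; rewrite flat1E.
  have : expR (- (n.+1%:R^-1 * y^-1)) @[n --> \oo] --> expR (- (0 * y^-1)).
    apply: continuous_cvg; first exact: continuous_expR.
    by apply: cvgN; apply: cvgMl; exact: cvg_harmonic.
  by rewrite mul0r oppr0 expR0.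
rewrite /box_bump.
elim: (index_enum _) => [|i s IH].
  rewrite (_ : (fun n => _) = cst 1); first exact: cvg_cst.
  by apply/funext => n; rewrite big_nil.
rewrite (_ : (fun n => _) = (fun n => (flat n.+1%:R^-1 1 (1 * x ord0 i + (- a ord0 i)) *
                 flat n.+1%:R^-1 1 ((-1) * x ord0 i + b ord0 i)) *
  \prod_(i <- s) (flat n.+1%:R^-1 1 (1 * x ord0 i + (- a ord0 i)) *
                 flat n.+1%:R^-1 1 ((-1) * x ord0 i + b ord0 i)))); last first.
  by apply/funext => n; rewrite big_cons.
have /andP[xa xb] := xab i.
rewrite -[X in _ --> X]mul1r; apply: cvgM IH.
rewrite -[X in _ --> X]mul1r; apply: cvgM; apply: cv.
  by rewrite mul1r subr_gt0.
by rewrite mulN1r addrC subr_gt0.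
Qed.

Lemma box_bump_test (D : set E) e a b : 0 < e -> cbox a b `<=` D ->
  test_fun D (box_bump e a b).
Proof.
move=> e0 abD; split; first exact: bump_alg_smooth (bump_alg_box e a b).
exists (cbox a b); split => //.
  rewrite (_ : cbox a b = [set x | forall i, `[a ord0 i, b ord0 i]%classic (x ord0 i)]).
    apply: (@rV_compact _ _ (fun i => `[a ord0 i, b ord0 i]%classic)) => i.
    exact: segment_compact.
  by apply/seteqP; split => x /= h i; have := h i; rewrite /= in_itv/=.
move=> x xab; apply: box_bump_out; apply: contra_not xab => xab i.
by have /andP[/ltW -> /ltW ->] := xab i.
Qed.

End bump.

(** * The fundamental lemma of the calculus of variations *)

Section boxes.
Context {R : realType} {d : nat}.
Local Notation E := 'rV[R]_d.

Definition oboxes : set (set E) := [set obox ab.1 ab.2 | ab in [set: E * E]].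

Lemma obox_setI (a b a' b' : E) : obox a b `&` obox a' b' =
  obox (\row_i Num.max (a ord0 i) (a' ord0 i)) (\row_i Num.min (b ord0 i) (b' ord0 i)).
Proof.
apply/seteqP; split => x /=.
  by move=> [h h'] i; rewrite !mxE gt_max lt_min; have /andP[-> ->] := h i; have /andP[-> ->] := h' i.
move=> h; split=> i; have := h i; rewrite !mxE gt_max lt_min.
  by move=> /andP[/andP[-> _] /andP[-> _]].
by move=> /andP[/andP[_ ->] /andP[_ ->]].
Qed.

Lemma measurable_oboxes : @measurable _ E = <<s oboxes >>.
Proof.
apply/seteqP; split; last first.
  apply: smallest_sub; first exact: sigma_algebra_measurable.
  by move=> _ [[a b] _ <-]; exact: measurable_obox.
apply: smallest_sub; first exact: smallest_sigma_algebra.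
move=> S; rewrite -bigcup_seq => -[i _ [C mC <-]].
have mi : @measurable_fun _ _ (g_sigma_algebraType oboxes) _ setT (fun x : E => x ord0 i : R).
  apply: (measurability _ (RGenOpens.measurableE R)).
  move=> _ [_ [a [b ->]] <-]; rewrite setTI.
  rewrite (_ : _ @^-1` _ = \bigcup_n obox (\row_j if j == i then a else - n%:R)
     (\row_j if j == i then b else n%:R)).
    apply: bigcupT_measurable => n; apply: sub_sigma_algebra.
    by eexists (_, _).
  apply/seteqP; split => x /=; last first.
    move=> [n _] /(_ i); rewrite !mxE eqxx; by rewrite in_itv.
  rewrite in_itv/= => xab.
  exists (Num.truncn `|x|).+1 => // j; rewrite !mxE; case: eqP => [->//|_].
  rewrite -ltr_norml (le_lt_trans (coord_le_norm x j))//.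
  exact: truncnS_gt.
exact: mi.
Qed.

End boxes.

Section fundamental_lemma.
Context {R : realType} {d : nat}.
Local Notation E := 'rV[R]_d.
Local Notation leb := (lebesgue_rV d).
Variables (D : set E) (g : E -> R).
Hypotheses (oD : open D) (ig : leb.-integrable D (EFin \o g)).
Hypothesis g0 : forall psi, test_fun D psi -> \int[leb]_(x in D) (g x * psi x) = 0.

Let mD : measurable D. Proof. exact: open_measurable_rV. Qed.

(** The bumps of the box converge to its indicator and are bounded by 1, so
    dominated convergence applies with [`|g|] as dominating function. *)
Lemma integral_obox_eq0 a b : cbox a b `<=` D ->
  (\int[leb]_(x in obox a b) (g x)%:E = 0)%E.
Proof.
move=> abD.
have obD : obox a b `<=` D.
  by move=> x xab; apply: abD => i; have /andP[/ltW -> /ltW ->] := xab i.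
pose psi n := box_bump n.+1%:R^-1 a b : E -> R.
have e0 n : 0 < n.+1%:R^-1 :> R by rewrite invr_gt0.
have psi01 n x : 0 <= psi n x <= 1 by apply: box_bump_itv; exact: ltW.
have mg : measurable_fun D g by apply/measurable_EFinP; case/integrableP: ig.
have mpsi n : measurable_fun D (psi n).
  apply: measurable_funTS; apply: continuous_measurable_rV.
  exact: bump_alg_continuous (e0 n) (bump_alg_box _ _ _).
have mgpsi n : measurable_fun D (fun x => (g x * psi n x)%:E).
  by apply/measurable_EFinP; exact: measurable_funM.
have gpsi_le n x : (`|(g x * psi n x)%:E| <= `|(g x)%:E|)%E.
  have /andP[p0 p1] := psi01 n x.
  by rewrite !abse_EFin lee_fin normrM (ger0_norm p0) ler_piMr.
have cv : (\int[leb]_(x in D) (g x * psi n x)%:E)%E @[n --> \oo] -->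
    (\int[leb]_(x in D) (EFin \o (g \_ (obox a b))) x)%E.
  have [] := @dominated_convergence _ _ _ leb D mD
    (fun n x => (g x * psi n x)%:E) (EFin \o (g \_ (obox a b))) (abse \o (EFin \o g)).
  - exact: mgpsi.
  - apply/measurable_EFinP/measurable_restrict => //; first exact: measurable_obox.
    by apply: measurable_funS mg => // x [].
  - apply: aeW => x Dx; apply/cvg_EFin; first exact: nearW.
    rewrite /= patchE; case: ifPn => [/set_mem xab|/negP xab].
      rewrite -[X in _ --> X]mulr1; apply: cvgMr.
      exact: box_bump_in.
    rewrite (_ : _ \o _ = cst 0); first exact: cvg_cst.
    apply/funext => n /=; rewrite /psi box_bump_out ?mulr0//.
    by move=> h; apply: xab; rewrite inE.
  - exact: integrable_abse.
  - by apply: aeW => x n _; exact: gpsi_le.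
  by [].
have z n : (\int[leb]_(x in D) (g x * psi n x)%:E = 0)%E.
  have := g0 (box_bump_test (e0 n) abD); rewrite /Rintegral => h.
  rewrite -[LHS]fineK ?h//.
  apply: integrable_fin_num => //.
  by apply: le_integrable ig => // x Dx; exact: gpsi_le.
move: cv; rewrite (_ : (fun n => _) = cst 0%E); last exact/funext.
move=> /(cvg_lim (@ereal_hausdorff R)); rewrite lim_cst// => /esym.
under eq_integral do rewrite -restrict_EFin.
by rewrite -integral_mkcondr setIidr.
Qed.

(** Boxes are stable under intersection and generate the Borel sets, hence by
    Dynkin's lemma the integral of [g] vanishes on all Borel subsets of the box. *)
Lemma ae_eq0_cbox a b : cbox a b `<=` D ->
  ae_eq leb (obox a b) (EFin \o g) (cst 0%E).
Proof.
move=> abD.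
have obD : obox a b `<=` D.
  by move=> x xab; apply: abD => i; have /andP[/ltW -> /ltW ->] := xab i.
have mab := measurable_obox a b.
have igab : leb.-integrable (obox a b) (EFin \o g) by exact: integrableS ig.
suff H S : <<s oboxes >> S -> (\int[leb]_(x in obox a b `&` S) (g x)%:E = 0)%E.
  apply: integral_ae_eq => // S Sab; rewrite measurable_oboxes => mS.
  by rewrite integral0 -(H S mS) setIidr.
move: S; apply: dynkin_induction.
- exact: measurable_oboxes.
- move=> _ _ [[a1 b1] _ <-] [[a2 b2] _ <-]; rewrite obox_setI.
  by eexists (_, _).
- by rewrite setIT integral_obox_eq0.
- move=> _ [[a1 b1] _ <-]; rewrite obox_setI integral_obox_eq0// => x xab.
  apply: abD => i; have := xab i.
  by rewrite !mxE ge_max le_min => /andP[/andP[-> _] /andP[-> _]].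
- move=> S mS S0.
  have := integral_obox_eq0 abD; rewrite -{1}(setUIDK (obox a b) S).
  rewrite integral_setU_EFin//; first by rewrite S0 add0e setDE.
  + exact: measurableI.
  + exact: measurableD.
  + by rewrite setUIDK; case/integrableP: igab => /measurable_EFinP.
  + by apply/disj_setPLR => x [_ /[swap] -[]].
- move=> F mF tF F0; rewrite setI_bigcupr integral_bigcup.
  + by rewrite eseries0// => n _ _; exact: F0.
  + exact: trivIset_setIl.
  + by move=> n; exact: measurableI.
  + apply: integrableS igab => //; last by move=> x [n _ []].
    by apply: bigcupT_measurable => n; exact: measurableI.
Qed.

(** The open set is a countable union of rational boxes whose closures it
    contains. *)
Lemma fundamental_lemma_calculus_variations : ae_on D (fun x => g x = 0).
Proof.
rewrite /ae_on.
pose good (q : 'rV[rat]_d * 'rV[rat]_d) := cbox (rat_rV q.1 : E) (rat_rV q.2) `<=` D.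
pose bad n : set E := 
  if (choice.unpickle n : option ('rV[rat]_d * 'rV[rat]_d)) is Some q then
  [set x | [/\ good q, obox (rat_rV q.1) (rat_rV q.2) x & g x <> 0]] else set0.
have nbad n : leb.-negligible (bad n).
  rewrite /bad; case: choice.unpickle => [q|]; last exact: negligible_set0.
  have [gq|ngq] := pselect (good q); last first.
    by apply: negligibleS (negligible_set0 _) => x [/ngq].
  have := ae_eq0_cbox gq; rewrite /ae_eq; apply: negligibleS.
  by move=> x /= [_ xq gx]; apply: contra_not gx => /(_ xq)[].
apply: negligibleS (negligible_bigcup nbad) => x /=.
move=> /not_implyP[]; rewrite {1}(open_bigcup_obox oD) => -[q /= qD xq] gx.
exists (choice.pickle q) => //; by rewrite /bad choice.pickleK.
Qed.

End fundamental_lemma.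

(** * Square-integrable functions *)

Section L2.
Context {R : realType} {d : nat}.
Local Notation E := 'rV[R]_d.
Local Notation leb := (lebesgue_rV d).
Variables (D : set E).
Hypotheses (mD : measurable D).

Lemma inLp_measurable p f : inLp D p f -> measurable_fun D f.
Proof.
rewrite /inLp /= inE => /andP[mf _]; apply/(measurable_restrictT _ mD).
by move: mf; rewrite inE.
Qed.

Lemma inL2P f : inLp D 2%:E f <->
  measurable_fun D f /\ leb.-integrable D (fun x => (f x ^+ 2)%:E).
Proof.
have E1 : (fun x => (f x ^+ 2)%:E) \_ D = EFin \o (fun x => (f \_ D) x ^+ 2).
  apply/funext => x; rewrite /= !patchE; case: ifP => // _.
  by rewrite expr0n.
split=> [|[mf i2]].
  move=> h; split; first exact: inLp_measurable h.
  rewrite integrable_mkcond//= E1.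
  exact: Lfun2_integrable_sqr.
rewrite /inLp /= inE; apply/andP; split; rewrite inE/=.
  exact/(measurable_restrictT _ mD).
move: i2; rewrite integrable_mkcond//= E1 => /integrableP[_].
rewrite /finite_norm unlock /= => h.
apply: poweR_lty; apply: le_lt_trans h.
rewrite le_eqVlt; apply/orP; left; apply/eqP; apply: eq_integral => x _.
by rewrite /= normrX powR_mulrn.
Qed.

Lemma inL2_lin (c : R) f g : inLp D 2%:E f -> inLp D 2%:E g ->
  inLp D 2%:E (fun x => c * f x + g x).
Proof.
rewrite /inLp /= => Lf Lg.
rewrite (_ : _ \_ D = (c *: (f \_ D)) + (g \_ D)).
  apply: (Lfun_submod_closed leb (lee1n 2)).2 => //.
apply/funext => x.
have -> : (c *: (f \_ D) + (g \_ D)) x = c * (f \_ D) x + (g \_ D) x by [].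
by rewrite !patchE; case: ifP => //; rewrite mulr0 addr0.
Qed.

Lemma inL2_mul f g : inLp D 2%:E f -> inLp D 2%:E g ->
  leb.-integrable D (EFin \o (fun x => f x * g x)).
Proof.
move=> Lf Lg.
have /Lfun1_integrable h := Lfun2_mul_Lfun1 Lf Lg.
rewrite integrable_mkcond//=; move: h; congr (integrable _ _ _); apply/funext => x.
rewrite /= !patchE; case: ifP => // _; by rewrite mul0r.
Qed.

Lemma inL2_dominated (f g : E -> R) (C : R) : measurable_fun D f -> inLp D 2%:E g ->
  ae_on D (fun x => `|f x| <= C * `|g x|) -> inLp D 2%:E f.
Proof.
move=> mf /inL2P[mg ig] fg; apply/inL2P; split=> //.
have iC : leb.-integrable D (fun x => (C ^+ 2)%:E * (g x ^+ 2)%:E)%E by exact: integrableZl.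
have mf2 : measurable_fun D (fun x => (f x ^+ 2)%:E).
  by apply/measurable_EFinP; exact: measurable_funX.
apply/integrableP; split => //.
case/integrableP: iC => mC; apply: le_lt_trans.
apply: ae_ge0_le_integral => //.
- exact: measurableT_comp.
- exact: measurableT_comp.
rewrite /ae_on in fg; apply: filterS fg => x /= h Dx; have {}h := h Dx.
rewrite /= lee_fin (normrM (C ^+ 2)) !normrX -exprMn lerXn2r ?nnegrE ?mulr_ge0//.
by apply: le_trans h _; rewrite ler_wpM2r// ler_norm.
Qed.

Lemma ae_eq_Rintegral (f g : E -> R) : measurable_fun D f -> measurable_fun D g ->
  ae_on D (fun x => f x = g x) ->
  \int[leb]_(x in D) f x = \int[leb]_(x in D) g x.
Proof.
move=> mf mg fg; congr fine; apply: ae_eq_integral => //; try exact/measurable_EFinP.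
by rewrite /ae_on in fg; apply: filterS fg => x /= h Dx; rewrite h.
Qed.


Lemma ae_onW (P : E -> Prop) : (forall x, D x -> P x) -> ae_on D P.
Proof. by move=> h; apply: aeW => x; exact: h. Qed.

Lemma ae_onS (P Q : E -> Prop) : (forall x, D x -> P x -> Q x) ->
  ae_on D P -> ae_on D Q.
Proof. by rewrite /ae_on => h; apply: filterS => x /= Px Dx; apply: h => //; exact: Px. Qed.

Lemma ae_onI (P Q : E -> Prop) : ae_on D P -> ae_on D Q ->
  ae_on D (fun x => P x /\ Q x).
Proof. by rewrite /ae_on => hP hQ; apply: filterS2 hP hQ => x /= p q Dx; split; [exact: p|exact: q]. Qed.

Lemma ae_on_seq (I : eqType) (s : seq I) (P : I -> E -> Prop) :
  (forall i, i \in s -> ae_on D (P i)) -> ae_on D (fun x => forall i, i \in s -> P i x).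
Proof.
elim: s => [_|i s IH h]; first exact: ae_onW.
have hs : ae_on D (fun x => forall j, j \in s -> P j x).
  by apply: IH => j js; apply: h; rewrite inE js orbT.
apply: ae_onS (ae_onI (h i _) hs); last by rewrite inE eqxx.
by move=> x _ [Pi Ps] j; rewrite inE => /orP[/eqP ->|/Ps].
Qed.

(** [g - f] and its absolute value have the same integral. *)
Lemma ae_le_Rintegral (f g : E -> R) :
  leb.-integrable D (EFin \o f) -> leb.-integrable D (EFin \o g) ->
  ae_on D (fun x => f x <= g x) ->
  \int[leb]_(x in D) f x <= \int[leb]_(x in D) g x.
Proof.
move=> fi gi fg.
have mf : measurable_fun D f by case/integrableP: fi => /measurable_EFinP.
have mg : measurable_fun D g by case/integrableP: gi => /measurable_EFinP.
have mgf : measurable_fun D (fun x => g x - f x) by exact: measurable_funB.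
rewrite -subr_ge0 -RintegralB// (ae_eq_Rintegral mgf (g := fun x => `|g x - f x|)).
- exact: Rintegral_ge0.
- exact: measurableT_comp.
- by apply: ae_onS fg => x _ h; rewrite ger0_norm// subr_ge0.
Qed.

Lemma ipL2C f g : ipL2 D f g = ipL2 D g f.
Proof. by apply: eq_Rintegral => x _; rewrite mulrC. Qed.

Lemma ipL2_lin c f g h : inLp D 2%:E f -> inLp D 2%:E g -> inLp D 2%:E h ->
  ipL2 D (fun x => c * f x + g x) h = c * ipL2 D f h + ipL2 D g h.
Proof.
move=> Lf Lg Lh; rewrite /ipL2 -RintegralZl//; last exact: inL2_mul.
rewrite -RintegralD//; last 2 first.
  - exact: (integrableZl mD c (inL2_mul Lf Lh)).
  - exact: inL2_mul.
by apply: eq_Rintegral => x _; rewrite mulrDl mulrA.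
Qed.

Lemma ipL2_ae f f' g : inLp D 2%:E f -> inLp D 2%:E f' -> inLp D 2%:E g ->
  ae_on D (fun x => f x = f' x) -> ipL2 D f g = ipL2 D f' g.
Proof.
move=> /inLp_measurable mf /inLp_measurable mf' /inLp_measurable mg ff'.
apply: ae_eq_Rintegral; [exact: measurable_funM|exact: measurable_funM|].
by apply: ae_onS ff' => x _ ->.
Qed.

Lemma ipL2_ge0 f : 0 <= ipL2 D f f.
Proof. by apply: Rintegral_ge0 => x _; rewrite -expr2 sqr_ge0. Qed.

Lemma ipL2_eq0 f : inLp D 2%:E f -> ipL2 D f f = 0 -> ae_on D (fun x => f x = 0).
Proof.
move=> Lf; have ff := inL2_mul Lf Lf; rewrite /ipL2 /Rintegral => h.
have h0 : (\int[leb]_(x in D) `|(f x * f x)%:E| = 0)%E.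
  under eq_integral => x _ do rewrite abse_EFin ger0_norm -?expr2 ?sqr_ge0// expr2.
  by rewrite -[LHS]fineK ?h//; exact: integrable_fin_num.
have mff : measurable_fun D (fun x => (f x * f x)%:E) by case/integrableP: ff.
have := (ae_eq_integral_abs leb mD mff).1 h0.
rewrite /ae_on /ae_eq; apply: filterS => x /= h1 Dx; have [] := h1 Dx.
by move/eqP; rewrite mulf_eq0 orbb => /eqP.
Qed.

Lemma dotv_integrable_sum u v : inLpv D 2%:E u -> inLpv D 2%:E v ->
  leb.-integrable D (EFin \o (fun x => dotv (u x) (v x))) /\
  ipL2v D u v = \sum_i ipL2 D (fun x => u x ord0 i) (fun x => v x ord0 i).
Proof.
move=> Lu Lv; rewrite /ipL2v /dotv /ipL2.
elim: (index_enum _) => [|i s [IH1 IH2]].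
  rewrite big_nil; split.
    rewrite (_ : _ \o _ = cst 0%E); first exact: integrable0.
    by apply/funext => x; rewrite /= big_nil.
  under eq_Rintegral do rewrite big_nil.
  by rewrite /Rintegral integral0.
have iu : leb.-integrable D (EFin \o (fun x => u x ord0 i * v x ord0 i)) by exact: inL2_mul.
split.
  have := integrableD mD iu IH1; congr (integrable _ _ _).
  by apply/funext => x; rewrite /= big_cons.
rewrite big_cons -IH2 -RintegralD//.
by under eq_Rintegral do rewrite big_cons.
Qed.

Lemma dotv_integrable u v : inLpv D 2%:E u -> inLpv D 2%:E v ->
  leb.-integrable D (EFin \o (fun x => dotv (u x) (v x))).
Proof. by move=> Lu Lv; have [] := dotv_integrable_sum Lu Lv. Qed.

Lemma ipL2vE u v : inLpv D 2%:E u -> inLpv D 2%:E v ->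
  ipL2v D u v = \sum_i ipL2 D (fun x => u x ord0 i) (fun x => v x ord0 i).
Proof. by move=> Lu Lv; have [] := dotv_integrable_sum Lu Lv. Qed.

Lemma inL2v_lin (c : R) u v : inLpv D 2%:E u -> inLpv D 2%:E v ->
  inLpv D 2%:E (fun x => c *: u x + v x).
Proof.
move=> Lu Lv i /=.
rewrite (_ : (fun x => _) = (fun x => c * u x ord0 i + v x ord0 i)).
  exact: inL2_lin (Lu i) (Lv i).
by apply/funext => x; rewrite !mxE.
Qed.

Lemma ipL2vC u v : ipL2v D u v = ipL2v D v u.
Proof. by apply: eq_Rintegral => x _; apply: eq_bigr => i _; rewrite mulrC. Qed.

Lemma ipL2v_lin c u v w : inLpv D 2%:E u -> inLpv D 2%:E v -> inLpv D 2%:E w ->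
  ipL2v D (fun x => c *: u x + v x) w = c * ipL2v D u w + ipL2v D v w.
Proof.
move=> Lu Lv Lw; rewrite !ipL2vE//; last exact: inL2v_lin.
rewrite mulr_sumr -big_split; apply: eq_bigr => i _ /=.
rewrite -(ipL2_lin c (Lu i) (Lv i) (Lw i)); congr (ipL2 _ _ _).
by apply/funext => x; rewrite !mxE.
Qed.

Lemma ipL2v_ae u u' w : inLpv D 2%:E u -> inLpv D 2%:E u' -> inLpv D 2%:E w ->
  ae_on D (fun x => u x = u' x) -> ipL2v D u w = ipL2v D u' w.
Proof.
move=> Lu Lu' Lw uu'; rewrite !ipL2vE//; apply: eq_bigr => i _.
by apply: ipL2_ae => //; apply: ae_onS uu' => x _ ->.
Qed.

Lemma ipL2v_ge0 u : inLpv D 2%:E u -> 0 <= ipL2v D u u.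
Proof. by move=> Lu; rewrite ipL2vE// sumr_ge0// => i _; exact: ipL2_ge0. Qed.

Lemma ipL2v_eq0 u : inLpv D 2%:E u -> ipL2v D u u = 0 -> ae_on D (fun x => u x = 0).
Proof.
move=> Lu; rewrite ipL2vE// => /eqP; rewrite psumr_eq0; last first.
  by move=> i _; exact: ipL2_ge0.
move=> /allP h; have := @ae_on_seq _ (index_enum 'I_d) (fun i x => u x ord0 i = 0).
move=> /(_ _)/ae_onS; apply => [x _ ux|i /h /eqP].
  by apply/rowP => i; rewrite mxE ux.
exact: ipL2_eq0.
Qed.

End L2.

(** * Weak divergences *)

Section divergence.
Context {R : realType} {d : nat}.
Local Notation E := 'rV[R]_d.
Local Notation leb := (lebesgue_rV d).
Variables (D : set E).
Hypotheses (oD : open D) (bD : bounded_set D).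

Let mD : measurable D. Proof. exact: open_measurable_rV. Qed.

Lemma bounded_inL2 (f : E -> R) (C : R) : measurable_fun D f ->
  (forall x, D x -> `|f x| <= C) -> inLp D 2%:E f.
Proof.
move=> mf fC.
have L1 : inLp D 2%:E (cst 1 : E -> R).
  apply/inL2P => //; split; first exact: measurable_cst.
  rewrite (_ : (fun x => _) = (EFin \o cst 1)); last by apply/funext => x /=; rewrite expr1n.
  apply/integrableP; split; first by apply/measurable_EFinP; exact: measurable_cst.
  under eq_integral do rewrite /= normr1.
  by rewrite integral_cst// mul1e; exact: bounded_lebesgue_finite.
apply: (inL2_dominated (C := C) mD mf L1).
by apply: ae_onW => x Dx; rewrite normr1 mulr1; exact: fC.
Qed.

Lemma continuous_inL2 (f : E -> R) : continuous f -> inLp D 2%:E f.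
Proof.
move=> cf.
have cD : compact (closure D).
  apply: bounded_closed_compact; last exact: closed_closure.
  case: bD => M [Mr DM]; exists M; split => // N MN x clx /=.
  have : closed [set y : E | `|y| <= N].
    rewrite (_ : [set _ | _] = (fun y : E => `|y|) @^-1` [set t | t <= N])//.
    apply: closed_comp => [y _|]; first exact: norm_continuous.
    exact: closed_le.
  move=> /closure_id cl; suff : closure [set y : E | `|y| <= N] x by rewrite -cl.
  by apply: closure_subset clx => y Dy; exact: DM.
have cfD : compact (f @` closure D).
  by apply: continuous_compact => //; exact: continuous_subspaceT.
have [M [Mr HM]] := compact_bounded cfD.
apply: (@bounded_inL2 _ (M + 1)).
  by apply: measurable_funTS; exact: continuous_measurable_rV.
move=> x Dx; apply: (HM (M + 1)); first by rewrite ltrDl.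
by exists x => //; exact: subset_closure.
Qed.

Lemma test_fun_inL2 psi : test_fun D psi -> inLp D 2%:E psi.
Proof. by move=> [/(_ [::])[cpsi _] _]; exact: continuous_inL2. Qed.

Lemma test_fun_grad_inL2 psi : test_fun D psi -> inLpv D 2%:E (grad psi).
Proof.
move=> [spsi _] i; rewrite (_ : (fun x => _) = partial i psi); last first.
  by apply/funext => x; rewrite mxE.
by apply: continuous_inL2; have [] := spsi [:: i].
Qed.

Lemma integrable_inL2 f : inLp D 2%:E f -> leb.-integrable D (EFin \o f).
Proof.
move=> Lf; have L1 : inLp D 2%:E (cst 1 : E -> R).
  apply: (@bounded_inL2 _ 1); first exact: measurable_cst.
  by move=> x _; rewrite normr1.
have := inL2_mul mD Lf L1; congr (integrable _ _ _).
by apply/funext => x /=; rewrite mulr1.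
Qed.

(** All the linearity of [div] comes from here: any function that satisfies the
    defining identity of a weak divergence is the chosen one almost everywhere. *)
Lemma is_div_unique v g g' : is_div D v g -> is_div D v g' ->
  ae_on D (fun x => g x = g' x).
Proof.
move=> [Lg hg] [Lg' hg'].
have Lgg : inLp D 2%:E (fun x => -1 * g' x + g x) by exact: inL2_lin.
have H : ae_on D (fun x => -1 * g' x + g x = 0).
  apply: fundamental_lemma_calculus_variations => //; first exact: integrable_inL2.
  move=> psi tpsi; have Lpsi := test_fun_inL2 tpsi.
  have /eqP := hg psi tpsi; rewrite hg'// eqr_opp => /eqP h.
  by rewrite -/(ipL2 D _ psi) ipL2_lin// h mulN1r addNr.
by apply: ae_onS H => x _; rewrite mulN1r addrC => /subr0_eq.
Qed.

Lemma divP v : Hdiv D v -> is_div D v (div D v).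
Proof. by move=> [_ vg]; exact: (@xgetPex _ _ (is_div D v)). Qed.

Lemma div_inL2 v : Hdiv D v -> inLp D 2%:E (div D v).
Proof. by move=> /divP[]. Qed.

Lemma is_div_lin c u v g g' : inLpv D 2%:E u -> inLpv D 2%:E v ->
  is_div D u g -> is_div D v g' ->
  is_div D (fun x => c *: u x + v x) (fun x => c * g x + g' x).
Proof.
move=> Lu Lv [Lg hg] [Lg' hg']; split; first exact: inL2_lin.
move=> psi tpsi; rewrite ipL2v_lin//; last exact: test_fun_grad_inL2.
by rewrite ipL2_lin//; [rewrite hg// hg'// mulrN opprD|exact: test_fun_inL2].
Qed.

Lemma Hdiv_lin c u v : Hdiv D u -> Hdiv D v -> Hdiv D (fun x => c *: u x + v x).
Proof.
move=> hu hv; split; first by apply: inL2v_lin => //; [case: hu|case: hv].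
by eexists; apply: is_div_lin (divP hu) (divP hv); [case: hu|case: hv].
Qed.

Lemma div_lin c u v : Hdiv D u -> Hdiv D v ->
  ae_on D (fun x => div D (fun x => c *: u x + v x) x = c * div D u x + div D v x).
Proof.
move=> hu hv; apply: is_div_unique (divP (Hdiv_lin c hu hv)) _.
by apply: is_div_lin (divP hu) (divP hv); [case: hu|case: hv].
Qed.

Lemma div_ae u v : Hdiv D u -> Hdiv D v -> ae_on D (fun x => u x = v x) ->
  ae_on D (fun x => div D u x = div D v x).
Proof.
move=> hu hv uv; apply: is_div_unique (divP hu) _.
have [Ldv hdv] := divP hv; split=> // psi tpsi.
rewrite -hdv//; apply: ipL2v_ae uv => //; [by case: hu|by case: hv|].
exact: test_fun_grad_inL2.
Qed.

Lemma H0div_lin c u v : H0div D u -> H0div D v -> H0div D (fun x => c *: u x + v x).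
Proof.
move=> [hu tu] [hv tv]; split; first exact: Hdiv_lin.
move=> phi g h; have [Lphi Lg _] := h.
rewrite ipL2v_lin//; [|by case: hu|by case: hv].
rewrite (ipL2_ae mD _ _ Lphi (div_lin c hu hv)); last 2 first.
- exact/div_inL2/Hdiv_lin.
- by apply: inL2_lin => //; exact: div_inL2.
rewrite ipL2_lin//; [|exact: div_inL2|exact: div_inL2].
by rewrite addrACA -mulrDr tu// tv// mulr0 addr0.
Qed.

Lemma bform_lin c u v q : H0div D u -> H0div D v -> inLp D 2%:E q ->
  bform D (fun x => c *: u x + v x) q = c * bform D u q + bform D v q.
Proof.
move=> [hu _] [hv _] Lq; rewrite /bform (ipL2_ae mD _ _ Lq (div_lin c hu hv)).
- by rewrite ipL2_lin//; exact: div_inL2.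
- exact/div_inL2/Hdiv_lin.
- by apply: inL2_lin => //; exact: div_inL2.
Qed.

Lemma bform_ae u v q : H0div D u -> H0div D v -> inLp D 2%:E q ->
  ae_on D (fun x => u x = v x) -> bform D u q = bform D v q.
Proof.
move=> [hu _] [hv _] Lq uv.
by apply: ipL2_ae (div_ae hu hv uv) => //; exact: div_inL2.
Qed.

End divergence.

(** * The coefficient and the energy form *)

Section pointwise.
Context {R : realType} {d : nat}.
Local Notation E := 'rV[R]_d.

Lemma mxactE (B : 'M[R]_d) (u : E) i : mxact B u ord0 i = \sum_j B i j * u ord0 j.
Proof. by rewrite /mxact mxE; apply: eq_bigr => j _; rewrite mxE mulrC. Qed.

Lemma mxact_lin (B : 'M[R]_d) c (u v : E) :
  mxact B (c *: u + v) = c *: mxact B u + mxact B v.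
Proof. by rewrite /mxact mulmxDl -scalemxAl. Qed.

Lemma dotvC (u v : E) : dotv u v = dotv v u.
Proof. by apply: eq_bigr => i _; rewrite mulrC. Qed.

Lemma dotv_linl c (u v w : E) : dotv (c *: u + v) w = c * dotv u w + dotv v w.
Proof.
rewrite /dotv mulr_sumr -big_split; apply: eq_bigr => i _ /=.
by rewrite !mxE mulrDl mulrA.
Qed.

Lemma dotv_linr c (u v w : E) : dotv w (c *: u + v) = c * dotv w u + dotv w v.
Proof. by rewrite dotvC dotv_linl ![dotv _ w]dotvC. Qed.

Lemma dotv0l (w : E) : dotv 0 w = 0.
Proof. by rewrite /dotv big1// => i _; rewrite mxE mul0r. Qed.

Lemma dotv_gt0 (u : E) : u != 0 -> 0 < dotv u u.
Proof.
have sq i : 0 <= u ord0 i * u ord0 i by rewrite -expr2 sqr_ge0.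
rewrite lt0r => u0; rewrite sumr_ge0 ?andbT//.
apply: contra_neq u0; move/eqP; rewrite psumr_eq0// => /allP h; apply/rowP => i.
by have := h i (mem_index_enum _); rewrite mulf_eq0 orbb mxE => /eqP.
Qed.

Lemma dotv_mxact_sym (B : 'M[R]_d) (u v : E) : B^T = B ->
  dotv (mxact B u) v = dotv (mxact B v) u.
Proof.
move=> BT; rewrite /dotv.
under eq_bigr do rewrite mxactE mulr_suml.
under [RHS]eq_bigr do rewrite mxactE mulr_suml.
rewrite exchange_big; apply: eq_bigr => j _; apply: eq_bigr => i _ /=.
by rewrite -{1}BT mxE mulrAC.
Qed.

Lemma quotient_bounds (B : 'M[R]_d) (a b : R) :
  (forall v : E, v != 0 -> a <= dotv (mxact B v) v / dotv v v <= b) ->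
  forall v, a * dotv v v <= dotv (mxact B v) v <= b * dotv v v.
Proof.
move=> h v; have [->|v0] := eqVneq v 0.
  by rewrite dotvC !dotv0l !mulr0 lexx.
have := h _ v0; have p := dotv_gt0 v0.
by rewrite ler_pdivlMr// ler_pdivrMr.
Qed.

(** Polarization: [4 B_ij] is the difference of the quadratic form at
    [e_i + e_j] and at [e_i - e_j]. *)
Lemma mx_entry_bound (B : 'M[R]_d) (a b : R) : 0 < a -> B^T = B ->
  (forall v, a * dotv v v <= dotv (mxact B v) v <= b * dotv v v) ->
  forall i j, `|B i j| <= b.
Proof.
move=> a0 BT h i j.
pose e k : E := delta_mx ord0 k.
have eE k m : e k ord0 m = (m == k)%:R by rewrite mxE eqxx.
have dote (w : E) l : dotv w (e l) = w ord0 l.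
  rewrite /dotv (bigD1 l)//= big1 ?addr0 ?eE ?eqxx ?mulr1// => m ml.
  by rewrite eE (negbTE ml) mulr0.
have ee k l : dotv (e k) (e l) = (k == l)%:R by rewrite dote eE eq_sym.
have Bee k l : dotv (mxact B (e k)) (e l) = B l k.
  rewrite dote mxactE (bigD1 k)//= big1 ?addr0 ?eE ?eqxx ?mulr1// => m mk.
  by rewrite eE (negbTE mk) mulr0.
have Bji : B j i = B i j by rewrite -{1}BT mxE.
have q (s : R) : dotv (mxact B (s *: e i + e j)) (s *: e i + e j) =
    s ^+ 2 * B i i + 2 * s * B i j + B j j.
  rewrite mxact_lin dotv_linl !dotv_linr.
  by rewrite !Bee Bji; ring.
have n (s : R) : dotv (s *: e i + e j) (s *: e i + e j) = s ^+ 2 + 2 * s * (i == j)%:R + 1.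
  rewrite dotv_linl !dotv_linr !ee !eqxx.
  by rewrite [j == i]eq_sym /=; ring.
have := h (1 *: e i + e j); have := h ((-1) *: e i + e j); rewrite !q !n.
have h1 : 0 <= (i == j)%:R :> R by [].
have h2 : (i == j)%:R <= 1 :> R by rewrite lern1 leq_b1.
move: ((i == j)%:R) h1 h2 => t t0 t1.
have := h (e i); have := h (e j); rewrite !Bee !ee !eqxx !mulr1.
move=> /andP[? ?] /andP[? ?] /andP[? ?] /andP[? ?].
rewrite ler_norml; apply/andP; split; nra.
Qed.

End pointwise.

Section coefficient.
Context {R : realType} {d : nat}.
Local Notation E := 'rV[R]_d.
Local Notation leb := (lebesgue_rV d).
Variables (D : set E) (A : E -> 'M[R]_d) (alpha beta : R).
Hypotheses (mD : measurable D) (hA : admissible_coef D A alpha beta).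

Local Notation B x := (invmx (A x)).

(** The identity [y^-1 = y * (y^2)^-1], valid also at 0, reduces inversion to a
    power of a nonnegative number. *)
Lemma measurable_inv (f : E -> R) : measurable_fun D f ->
  measurable_fun D (fun x => (f x)^-1).
Proof.
move=> mf.
rewrite (_ : (fun x => _) = (fun x => f x * ((f x ^+ 2) `^ (-1)))).
  apply: measurable_funM => //.
  apply: (measurableT_comp (measurable_powR _)) => //.
  exact: measurable_funX.
apply/funext => x; rewrite powR_inv1 ?sqr_ge0//.
have [->|f0] := eqVneq (f x) 0; first by rewrite invr0 mul0r.
by rewrite expr2 invfM mulrA divff// mul1r.
Qed.

Lemma measurable_det n (M : E -> 'M[R]_n) :
  (forall i j, measurable_fun D (fun x => M x i j)) -> measurable_fun D (fun x => \det (M x)).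
Proof.
move=> mM; rewrite /determinant; apply: measurable_sum => s.
apply: measurable_funM; first exact: measurable_cst.
by apply: measurable_prod => i _; exact: mM.
Qed.

(** Since [0^-1 = 0], the rational expression [1 - det * det^-1] is the indicator
    of the singular matrices, on which [invmx] is the identity. *)
Lemma measurable_invmx i j : measurable_fun D (fun x => B x i j).
Proof.
have mA k l : measurable_fun D (fun x => A x k l).
  by case: hA => LA _ _ _; apply: inLp_measurable (LA k l).
have mdet := measurable_det mA.
rewrite (_ : (fun x => _) = (fun x => (\det (A x))^-1 * (\adj (A x)) i j +
    (1 - \det (A x) * (\det (A x))^-1) * A x i j)).
  apply: measurable_funD; apply: measurable_funM => //.
  - exact: measurable_inv.
  - rewrite (_ : (fun x => _) = (fun x => cofactor (A x) j i)); last first.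
      by apply/funext => x; rewrite mxE.
    apply: measurable_funM; first exact: measurable_cst.
    apply: measurable_det => k l.
    rewrite (_ : (fun x => _) = (fun x => A x (lift j k) (lift i l))) //.
    by apply/funext => x; rewrite !mxE.
  - apply: measurable_funB; first exact: measurable_cst.
    by apply: measurable_funM => //; exact: measurable_inv.
apply/funext => x; rewrite /invmx unitmxE unitfE.
case: eqVneq => [->|d0]; first by rewrite invr0 mul0r mulr0 subr0 mul1r add0r.
by rewrite divff// subrr mul0r addr0 !mxE.
Qed.

Lemma coef_ae : ae_on D (fun x => (B x)^T = B x /\
  forall v : E, alpha * dotv v v <= dotv (mxact (B x) v) v <= beta * dotv v v).
Proof.
case: hA => _ AT _ Aell; apply: ae_onS (ae_onI AT Aell) => x _ [xT [_ xell]].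
by split; [rewrite trmx_inv xT|exact: quotient_bounds].
Qed.

Lemma alpha_gt0 : 0 < alpha. Proof. by case: hA => _ _ []. Qed.

Lemma coef_inL2 u : inLpv D 2%:E u -> inLpv D 2%:E (fun x => mxact (B x) (u x)).
Proof.
move=> Lu i.
have L j : inLp D 2%:E (fun x => B x i j * u x ord0 j).
  apply: (@inL2_dominated _ _ D mD _ (fun x => u x ord0 j) beta) => //.
    apply: measurable_funM; first exact: measurable_invmx.
    exact: inLp_measurable (Lu j).
  apply: ae_onS coef_ae => x _ [xT xell]; rewrite normrM ler_wpM2r//.
  exact: mx_entry_bound alpha_gt0 xT xell _ _.
rewrite (_ : (fun x => _) = (fun x => \sum_j B x i j * u x ord0 j)); last first.
  by apply/funext => x; rewrite mxactE.
elim: (index_enum _) => [|j s IH].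
  have := inL2_lin (-1) (L i) (L i); congr (inLp _ _ _).
  by apply/funext => x; rewrite big_nil mulN1r addNr.
have := inL2_lin 1 (L j) IH; congr (inLp _ _ _).
by apply/funext => x; rewrite big_cons mul1r.
Qed.

Lemma aformE u v : aform A D u v = ipL2v D (fun x => mxact (B x) (u x)) v.
Proof. by []. Qed.

Lemma aform_linl c u v w : inLpv D 2%:E u -> inLpv D 2%:E v -> inLpv D 2%:E w ->
  aform A D (fun x => c *: u x + v x) w = c * aform A D u w + aform A D v w.
Proof.
move=> Lu Lv Lw; rewrite !aformE -ipL2v_lin//; [|exact: coef_inL2|exact: coef_inL2].
by congr (ipL2v _ _ _); apply/funext => x; rewrite mxact_lin.
Qed.

Lemma aform_linr c u v w : inLpv D 2%:E u -> inLpv D 2%:E v -> inLpv D 2%:E w ->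
  aform A D w (fun x => c *: u x + v x) = c * aform A D w u + aform A D w v.
Proof.
move=> Lu Lv Lw; rewrite !aformE ![ipL2v D (fun x => mxact _ _) _]ipL2vC ipL2v_lin//.
exact: coef_inL2.
Qed.

Lemma aform_integrable u v : inLpv D 2%:E u -> inLpv D 2%:E v ->
  leb.-integrable D (EFin \o (fun x => dotv (mxact (B x) (u x)) (v x))).
Proof. by move=> Lu Lv; apply: dotv_integrable => //; exact: coef_inL2. Qed.

Lemma aform_sym u v : inLpv D 2%:E u -> inLpv D 2%:E v ->
  aform A D u v = aform A D v u.
Proof.
move=> Lu Lv; apply: ae_eq_Rintegral => //.
- by have /integrableP[/measurable_EFinP] := aform_integrable Lu Lv.
- by have /integrableP[/measurable_EFinP] := aform_integrable Lv Lu.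
by apply: ae_onS coef_ae => x _ [xT _]; exact: dotv_mxact_sym.
Qed.

Lemma aform_bounds u : inLpv D 2%:E u ->
  alpha * ipL2v D u u <= aform A D u u <= beta * ipL2v D u u.
Proof.
move=> Lu.
have iu := dotv_integrable mD Lu Lu; have ia := aform_integrable Lu Lu.
rewrite -!RintegralZl//; apply/andP; split; apply: ae_le_Rintegral => //.
- exact: (integrableZl mD alpha iu).
- by apply: ae_onS coef_ae => x _ [_ /(_ (u x))/andP[]].
- exact: (integrableZl mD beta iu).
- by apply: ae_onS coef_ae => x _ [_ /(_ (u x))/andP[]].
Qed.

Lemma aform_ae u u' v : inLpv D 2%:E u -> inLpv D 2%:E u' -> inLpv D 2%:E v ->
  ae_on D (fun x => u x = u' x) -> aform A D u v = aform A D u' v.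
Proof.
move=> Lu Lu' Lv uu'; apply: ipL2v_ae => //; [exact: coef_inL2|exact: coef_inL2|].
by apply: ae_onS uu' => x _ ->.
Qed.

Lemma aform_eq0 u : inLpv D 2%:E u -> aform A D u u = 0 -> ae_on D (fun x => u x = 0).
Proof.
move=> Lu au; apply: ipL2v_eq0 => //; apply/eqP; rewrite eq_le ipL2v_ge0// andbT.
have /andP[+ _] := aform_bounds Lu; rewrite au.
by rewrite pmulr_rle0// alpha_gt0.
Qed.

End coefficient.

(** * Integration over a mesh *)

Section null_difference.
Import HBNNSimple.
Local Open Scope ereal_scope.
Context d (T : measurableType d) (R : realType) (mu : {measure set T -> \bar R}).
Variables (S D N : set T).
Hypotheses (mN : measurable N) (N0 : mu N = 0) (SD : S `\` D `<=` N).

(** The integral is a supremum over simple functions, and a simple function may be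
    cut off on a null set; this covers integrands that are arbitrary, possibly not
    measurable, outside [D]. *)
Let ge0_integral_null_difference (f : T -> \bar R) : (forall x, 0 <= f x) ->
  \int[mu]_(x in S) f x <= \int[mu]_(x in S `&` D) f x.
Proof.
move=> f0; rewrite !ge0_integralE//; apply: ge_ereal_sup => _ [h hf <-].
have mNc := measurableC mN.
pose h' := proj_nnsfun h mNc.
have -> : sintegral mu h = sintegral mu h'.
  rewrite -!integralT_nnsfun; apply: ge0_ae_eq_integral => //.
  - exact/measurable_EFinP.
  - exact/measurable_EFinP.
  - by move=> x _; rewrite lee_fin.
  - by move=> x _; rewrite lee_fin.
  exists N; split => // x /= /not_implyP[_] hx; apply: contrapT => Nx; apply: hx.
  by rewrite /h' /= mindicE mem_set// mulr1.
apply: ereal_sup_ubound; exists h' => // x.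
rewrite /h' /= mindicE; have := hf x; rewrite !patchE.
have [xN|xN] := pselect (N x).
  have -> : (x \in ~` N) = false by apply: memNset => /=; exact.
  move=> _; rewrite mulr0.
  by case: ifP.
have -> : (x \in ~` N) = true by exact: mem_set.
rewrite mulr1; case: ifPn => [/set_mem Sx|xS hx].
  rewrite mem_set//; split => //; apply: contrapT => Dx; apply: xN; exact: SD.
by rewrite memNset// => -[/mem_set]; rewrite (negbTE xS).
Qed.

Lemma integral_null_difference (f : T -> \bar R) :
  \int[mu]_(x in S) f x = \int[mu]_(x in S `&` D) f x.
Proof.
have ge0 (g : T -> \bar R) : (forall x, 0 <= g x) ->
    \int[mu]_(x in S) g x = \int[mu]_(x in S `&` D) g x.
  move=> g0; apply/eqP; rewrite eq_le ge0_integral_null_difference//=.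
  rewrite !ge0_integralE//; apply: le_ereal_sup => _ [h hg <-]; exists h => // x.
  apply: le_trans (hg x) _; rewrite !patchE.
  case: ifPn => [/set_mem[Sx _]|_]; first by rewrite mem_set.
  by case: ifP.
by rewrite integralE ge0// ge0// -integralE.
Qed.

End null_difference.

Section simplices.
Context {R : realType} {d : nat}.
Local Notation E := 'rV[R]_d.
Local Notation leb := (lebesgue_rV d).
(* The convex hull, not the barycentric combination of convex spaces. *)
Local Notation conv := Defs.conv.
Implicit Types t e : {fset E}.

(** The hull is the image of a standard simplex of coefficients under a linear
    map. *)
Lemma compact_conv t : compact (conv t).
Proof.
pose s := enum_fset t; pose n := size s.
have us : uniq s by exact: fset_uniq.
pose F (c : 'rV[R]_n) : E := \sum_(i < n) c ord0 i *: nth 0 s i.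
pose K : set 'rV[R]_n := [set c : 'rV[R]_n | forall i, `[0, 1]%classic (c ord0 i)] `&`
   (fun c : 'rV[R]_n => \sum_(i < n) c ord0 i) @^-1` [set 1].
have cF : continuous F.
  apply: continuous_big => [|i _]; first exact: add_continuous.
  move=> c.
  by apply: (@continuousZr_tmp _ _ _ (fun c : 'rV[R]_n => c ord0 i)); exact: coord_continuous.
have cS : continuous (fun c : 'rV[R]_n => \sum_(i < n) c ord0 i).
  apply: continuous_big => [|i _]; first exact: add_continuous.
  exact: coord_continuous.
have cK : compact K.
  apply: compact_closedI.
    by apply: (@rV_compact R n (fun=> `[0 : R, 1 : R]%classic)) => i; exact: segment_compact.
  by apply: closed_comp => [y _|]; [exact: cS|exact: closed_eq].
suff -> : conv t = F @` K by apply: continuous_compact => //; exact: continuous_subspaceT.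
have si (i : 'I_n) : nth 0 s i \in s by rewrite mem_nth.
apply/seteqP; split => x.
  move=> [lam [lam0 lam1 ->]]; exists (\row_i lam (nth 0 s i)); last first.
    rewrite /F (big_nth 0) big_mkord; apply: eq_bigr => i _; by rewrite mxE.
  move: lam1; rewrite (big_nth 0) big_mkord => lam1; split => [i|] /=.
    rewrite mxE in_itv/= lam0/= -lam1 (bigD1 i)//= lerDl sumr_ge0//.
  by rewrite -lam1; apply: eq_bigr => i _; rewrite mxE.
move=> [c [/= c01 c1] <-].
exists (fun p => \sum_(i < n) c ord0 i * (nth 0 s i == p)%:R); split.
- move=> p; apply: sumr_ge0 => i _; rewrite mulr_ge0//.
  by have := c01 i; rewrite in_itv/= => /andP[].
- rewrite exchange_big/=; apply: etrans c1; apply: eq_bigr => i _.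
  rewrite (bigD1_seq (nth 0 s i))//= [X in _ + X]big1 => [|p].
    by rewrite addr0 eqxx /= mulr1.
  by rewrite eq_sym => /negbTE ->; rewrite mulr0.
- under eq_bigr do rewrite scaler_suml.
  rewrite exchange_big/=; apply: eq_bigr => i _.
  rewrite (bigD1_seq (nth 0 s i))//= [X in _ + X]big1 => [|p].
    by rewrite addr0 eqxx /= mulr1.
  by rewrite eq_sym => /negbTE ->; rewrite mulr0 scale0r.
Qed.

Lemma measurable_conv t : measurable (conv t).
Proof.
apply: closed_measurable_rV; apply: compact_closed; last exact: compact_conv.
exact: norm_hausdorff.
Qed.

(** Any [d] points of [R^d] lie in a common hyperplane [h . x = c]: [(h, c)]
    solves a homogeneous linear system with fewer equations than unknowns. *)
Lemma conv_null e : (#|` e|%fset <= d)%N -> leb.-negligible (conv e).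
Proof.
move=> ed; pose s := enum_fset e.
have sn : size s = #|` e|%fset by [].
case E0 : s => [|p0 s'].
  rewrite (_ : conv e = set0); first exact: negligible_set0.
  apply/seteqP; split => // x [lam [_ + _]].
  by rewrite -/s E0 big_nil => /esym/eqP; rewrite oner_eq0.
pose P : 'M[R]_(size s, d) := \matrix_(i, j) (nth 0 s i) ord0 j.
pose M : 'M[R]_(size s, d + 1) := row_mx P (const_mx (-1)).
have kM : kermx M^T != 0.
  rewrite -mxrank_eq0 mxrank_ker mxrank_tr -lt0n subn_gt0.
  by rewrite (leq_ltn_trans (rank_leq_row _))// addn1 ltnS sn.
pose u := nz_row (kermx M^T).
have u0 : u != 0 by rewrite nz_row_eq0.
have uM : u *m M^T = 0 by apply/sub_kermxP; exact: nz_row_sub.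
pose h := @lsubmx R 1 d 1 u; pose c := @rsubmx R 1 d 1 u ord0 ord0.
have hp p : p \in e -> dotv h p = c.
  move=> pe; have ps : (index p s < size s)%N by rewrite index_mem.
  move: uM; rewrite -[u]hsubmxK /M tr_row_mx mul_row_col => /rowP/(_ (Ordinal ps)).
  rewrite mxE [X in _ + X]mxE big_ord1 !mxE mulrN1 => /eqP; rewrite subr_eq0 => /eqP.
  rewrite /c mxE => <-; apply: eq_bigr => i _; rewrite !mxE /= nth_index//.
have h0 : h != 0.
  apply: contra_neq u0 => h0; have p0e : p0 \in e by rewrite -[p0 \in e]/(p0 \in s) E0 inE eqxx.
  have c0 : c = 0 by rewrite -(hp _ p0e) h0 dotv0l.
  rewrite -[u]hsubmxK -/h h0; apply/rowP => i.
  have [j ->|j ->] := @split_ordP d 1 i; first by rewrite row_mxEl !mxE.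
  by rewrite row_mxEr ord1 [RHS]mxE.
apply: (@negligibleS _ _ _ _ [set x | dotv h x = c]); last first.
  apply/negligibleP; last exact: hyperplane_null.
  exact: measurable_hyperplane.
move=> x [lam [_ lam1 ->]] /=.
transitivity (\sum_(p <- e) lam p * c); last by rewrite -mulr_suml lam1 mul1r.
rewrite [LHS]dotvC (_ : dotv _ _ = \sum_(p <- e) lam p * dotv p h).
  by apply: eq_big_seq => p pe; rewrite dotvC hp.
elim: (enum_fset e) => [|p r IH]; first by rewrite !big_nil dotv0l.
by rewrite !big_cons dotv_linl IH.
Qed.

End simplices.

Section mesh.
Context {R : realType} {d : nat}.
Local Notation E := 'rV[R]_d.
Local Notation leb := (lebesgue_rV d).
Local Notation conv := Defs.conv.
Variables (D : set E) (M : {fset {fset E}}).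
Hypotheses (mD : measurable D) (hM : conforming_mesh D M) (hD : polyhedral_boundary D).

Lemma mesh_cover x : D x -> exists2 t, t \in M & conv t x.
Proof.
by case: hM => _ _ clD /(@subset_closure _ D); rewrite clD.
Qed.

Lemma mesh_conv_closure t : t \in M -> conv t `<=` closure D.
Proof. by case: hM => _ _ clD tM x tx; rewrite clD; exists t. Qed.

(** Distinct simplices of a conforming mesh meet in the hull of at most [d]
    points, which is null. *)
Lemma mesh_ae_unique : ae_on D (fun x => forall t, t \in M -> forall t', t' \in M ->
  conv t x -> conv t' x -> t = t').
Proof.
apply: (@ae_on_seq _ _ _ _ (enum_fset M) (fun t x => forall t', t' \in M ->
  conv t x -> conv t' x -> t = t')) => t tM.
apply: (@ae_on_seq _ _ _ _ (enum_fset M) (fun t' x => conv t x -> conv t' x -> t = t')) => t' t'M.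
have [->|tt'] := eqVneq t t'; first exact: ae_onW.
case: hM => sM iM _.
have : leb.-negligible (conv (t `&` t')%fset).
  apply: conv_null; rewrite -ltnS.
  have [<- _] := sM t tM; apply: fproper_ltn_card.
  rewrite fproperE fsubsetIl/= fsubsetIidl; apply: contra tt' => tt'.
  by rewrite eqEfcard tt' (sM t tM).1 (sM t' t'M).1 /=.
apply: negligibleS => x /= /not_implyP[Dx]; apply: contra_notP => xt tx t'x.
by exfalso; apply: xt; rewrite -iM.
Qed.

(** Finitely many hyperplanes contain the boundary of a polyhedral domain. *)
Lemma boundary_null : exists N, [/\ measurable N, leb N = 0%E & closure D `\` D `<=` N].
Proof.
have [F [F0 FD]] := hD.
suff [N [mN N0 NF]] : leb.-negligible [set x | exists2 h, h \in F & dotv h.1 x = h.2].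
  by exists N; split=> //; apply: subset_trans NF.
elim: F F0 {FD} => [_|h F IH F0].
  by apply: negligibleS (negligible_set0 _) => x [].
have nh : leb.-negligible [set x | dotv h.1 x = h.2].
  apply/negligibleP; first exact: measurable_hyperplane.
  by apply: hyperplane_null; apply: F0; rewrite inE eqxx.
have nF : leb.-negligible [set x | exists2 h, h \in F & dotv h.1 x = h.2].
  by apply: IH => k kF; apply: F0; rewrite inE kF orbT.
apply: negligibleS (negligibleU nh nF) => x [k]; rewrite inE => /orP[/eqP ->|kF] kx.
  by left.
by right; exists k.
Qed.

(** A simplex may contain boundary points of [D], where [f] is arbitrary and the
    restriction of [f] possibly not measurable; such points form a null set. *)
Lemma Rintegral_conv t (f : E -> R) : t \in M ->
  \int[leb]_(x in conv t) f x = \int[leb]_(x in D) (f \_ (conv t)) x.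
Proof.
move=> tM; have [N [mN N0 DN]] := boundary_null.
rewrite -Rintegral_mkcondl; congr fine; apply: (integral_null_difference mN N0).
by move=> x [/(mesh_conv_closure tM) clx Dx]; apply: DN.
Qed.

(** Almost every point of [D] lies in exactly one simplex of the mesh. *)
Lemma sum_mesh_ae (V : zmodType) (f : {fset E} -> E -> V) (g : E -> V) :
  (forall t, t \in M -> ae_on D (fun x => conv t x -> f t x = g x)) ->
  ae_on D (fun x => \sum_(t <- M) (if x \in conv t then f t x else 0) = g x).
Proof.
move=> fg.
have H : ae_on D (fun x => forall t, t \in M -> conv t x -> f t x = g x).
  exact: (@ae_on_seq _ _ _ _ (enum_fset M)).
apply: ae_onS (ae_onI H mesh_ae_unique) => x Dx [fgx ux].
have [t tM tx] := mesh_cover Dx.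
rewrite (bigD1_seq t)//= ?fset_uniq// mem_set// fgx// big_seq_cond big1 ?addr0//.
move=> t' /andP[t'M t't]; case: ifPn => // /set_mem t'x.
by move: t't; rewrite (ux t' t'M t tM t'x tx) eqxx.
Qed.

Lemma sum_Rintegral_mesh (f : E -> R) : leb.-integrable D (EFin \o f) ->
  \sum_(t <- M) \int[leb]_(x in conv t) f x = \int[leb]_(x in D) f x.
Proof.
move=> fi.
have fti t : leb.-integrable D (EFin \o (f \_ (conv t))).
  rewrite (_ : _ \o _ = (EFin \o f) \_ (conv t)); last by rewrite restrict_EFin.
  have mt := measurable_conv t.
  apply/integrable_restrict => //.
  by apply: integrableS fi => //; exact: measurableI.
have [iS S] : leb.-integrable D (EFin \o (fun x => \sum_(t <- M) (f \_ (conv t)) x)) /\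
    \int[leb]_(x in D) (\sum_(t <- M) (f \_ (conv t)) x) =
    \sum_(t <- M) \int[leb]_(x in D) (f \_ (conv t)) x.
  elim: (enum_fset M) => [|t r [IH1 IH2]].
    rewrite big_nil; split.
      rewrite (_ : _ \o _ = cst 0%E); first exact: integrable0.
      by apply/funext => x; rewrite /= big_nil.
    by under eq_Rintegral do rewrite big_nil; rewrite /Rintegral integral0.
  split.
    have := integrableD mD (fti t) IH1; congr (integrable _ _ _).
    by apply/funext => x; rewrite /= big_cons.
  rewrite big_cons -IH2 -RintegralD//.
  by under eq_Rintegral do rewrite big_cons.
transitivity (\sum_(t <- M) \int[leb]_(x in D) (f \_ (conv t)) x).
  by apply: eq_big_seq => t tM; rewrite Rintegral_conv.
rewrite -S; apply: ae_eq_Rintegral => //.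
- by case/integrableP: iS => /measurable_EFinP.
- by case/integrableP: fi => /measurable_EFinP.
by apply: (@sum_mesh_ae R (fun t => f)) => t _; exact: ae_onW.
Qed.

End mesh.

(** * Finite-dimensional saddle point problems *)

Section linear_algebra.
Context {R : fieldType}.

Lemma row_solvable n (S : 'M[R]_n) (r : 'rV[R]_n) :
  (forall c : 'cV[R]_n, S *m c = 0 -> r *m c = 0) -> exists x, x *m S = r.
Proof.
move=> H; suff /submxP[x ->] : (r <= S)%MS by exists x.
rewrite submxE; apply/eqP/matrixP => i j.
have := H (col j (cokermx S)); rewrite colE mulmxA mulmx_coker mul0mx => /(_ erefl).
by rewrite mulmxA -colE => /matrixP/(_ i ord0); rewrite !mxE.
Qed.

(** Members of [C] forming a matrix of maximal rank span [C], since adjoining one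
    more member cannot increase the rank. *)
Lemma set_row_span n (C : set 'rV[R]_n) :
  exists k (M : 'M[R]_(k, n)), (forall i, C (row i M)) /\
    forall c, C c -> (c <= M)%MS.
Proof.
pose P r := `[< exists k (M : 'M[R]_(k, n)), (forall i, C (row i M)) /\ \rank M = r >].
have P0 : exists r, P r.
  by exists 0%N; apply/asboolP; exists 0%N, 0; split; [case|rewrite mxrank0].
have Pn r : P r -> (r <= n)%N by move=> /asboolP[k [M [_ <-]]]; exact: rank_leq_col.
case: (ex_maxnP P0 Pn) => r /asboolP[k [M [CM rM]]] rmax.
exists k, M; split => // c Cc; apply: contrapT => cM.
have : (\rank (col_mx M c) <= r)%N.
  apply: rmax; apply/asboolP; exists (k + 1)%N, (col_mx M c); split => // i.
  have [j ->|j ->] := split_ordP i; first by rewrite rowKu.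
  by rewrite rowKd row_id.
rewrite leqNgt -rM => /negP; apply; rewrite -addsmxE ltn_neqAle.
have [le eq] := mxrank_leqif_sup (addsmxSl M c).
rewrite le andbT eq; apply/negP => h; apply: cM.
exact: submx_trans (addsmxSr M c) h.
Qed.

End linear_algebra.

Section saddle_point.
Context {R : fieldType} {V Q : lmodType R}.
Variables (X : set V) (Y : set Q) (a : V -> V -> R) (b : V -> Q -> R) (l : Q -> R).
Hypotheses (X0 : X 0) (Y0 : Y 0).
Hypothesis XD : forall c u v, X u -> X v -> X (c *: u + v).
Hypothesis YD : forall c u v, Y u -> Y v -> Y (c *: u + v).
Hypothesis aDl : forall c u v w, X u -> X v -> X w ->
  a (c *: u + v) w = c * a u w + a v w.
Hypothesis aDr : forall c u v w, X u -> X v -> X w ->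
  a w (c *: u + v) = c * a w u + a w v.
Hypothesis bDl : forall c u v q, X u -> X v -> Y q ->
  b (c *: u + v) q = c * b u q + b v q.
Hypothesis bDr : forall c p q v, X v -> Y p -> Y q ->
  b v (c *: p + q) = c * b v p + b v q.
Hypothesis lD : forall c p q, Y p -> Y q -> l (c *: p + q) = c * l p + l q.

Lemma lin_sum (U : lmodType R) (Z : set U) (g : U -> R) :
  Z 0 -> (forall c u v, Z u -> Z v -> Z (c *: u + v)) ->
  (forall c u v, Z u -> Z v -> g (c *: u + v) = c * g u + g v) ->
  forall I (r : seq I) (c : I -> R) (z : I -> U), (forall i, Z (z i)) ->
  Z (\sum_(i <- r) c i *: z i) /\
  g (\sum_(i <- r) c i *: z i) = \sum_(i <- r) c i * g (z i).
Proof.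
move=> Z0 ZD gD I r c z Zz.
elim: r => [|i r [IH1 IH2]]; rewrite ?big_nil ?big_cons.
  split=> //; have := gD (-1) 0 0 Z0 Z0.
  by rewrite scaler0 addr0 mulN1r addNr.
by split; [exact: ZD|rewrite gD// IH2].
Qed.

Variables (m n : nat) (u_ : 'I_m -> V) (q_ : 'I_n -> Q).
Hypotheses (Xu : forall i, X (u_ i)) (Yq : forall i, Y (q_ i)).
(* Spanning is required only as far as the forms can see: elements of [X] and
   [Y] will be functions that matter up to null sets. *)
Hypothesis spanX : forall v, X v -> exists c : 'I_m -> R,
  [/\ forall w, X w -> a v w = a (\sum_i c i *: u_ i) w,
      forall w, X w -> a w v = a w (\sum_i c i *: u_ i) &
      forall p, Y p -> b v p = b (\sum_i c i *: u_ i) p].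
Hypothesis spanY : forall q, Y q -> exists c : 'I_n -> R,
  (forall w, X w -> b w q = b w (\sum_i c i *: q_ i)) /\
  l q = l (\sum_i c i *: q_ i).

(** The finite linear system is solvable as soon as its right-hand side is
    orthogonal to the solutions of the adjoint homogeneous system. *)
Lemma saddle_point_solvable :
  (forall u p, X u -> Y p -> (forall v, X v -> a v u + b v p = 0) ->
     (forall q, Y q -> b u q = 0) -> l p = 0) ->
  exists u p, [/\ X u, Y p, forall v, X v -> a u v + b v p = 0 &
    forall q, Y q -> b u q = l q].
Proof.
move=> uniq.
pose S : 'M[R]_(m + n) := block_mx (\matrix_(i, j) a (u_ i) (u_ j))
  (\matrix_(i, j) b (u_ i) (q_ j)) (\matrix_(i, j) b (u_ j) (q_ i)) 0.
pose r : 'rV[R]_(m + n) := row_mx 0 (\row_j l (q_ j)).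
have XS (c : 'I_m -> R) : X (\sum_i c i *: u_ i).
  by have [] := @lin_sum _ X (fun=> 0) X0 XD _ _ (index_enum _) c u_ Xu => // *; rewrite mulr0 addr0.
have YS (c : 'I_n -> R) : Y (\sum_i c i *: q_ i).
  by have [] := @lin_sum _ Y (fun=> 0) Y0 YD _ _ (index_enum _) c q_ Yq => // *; rewrite mulr0 addr0.
have aSl (c : 'I_m -> R) w : X w -> a (\sum_i c i *: u_ i) w = \sum_i c i * a (u_ i) w.
  by move=> Xw; have [] := @lin_sum _ X (a^~ w) X0 XD _ _ (index_enum _) c u_ Xu => // *; exact: aDl.
have aSr (c : 'I_m -> R) w : X w -> a w (\sum_i c i *: u_ i) = \sum_i c i * a w (u_ i).
  by move=> Xw; have [] := @lin_sum _ X (a w) X0 XD _ _ (index_enum _) c u_ Xu => // *; exact: aDr.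
have bSl (c : 'I_m -> R) q : Y q -> b (\sum_i c i *: u_ i) q = \sum_i c i * b (u_ i) q.
  by move=> Xw; have [] := @lin_sum _ X (b^~ q) X0 XD _ _ (index_enum _) c u_ Xu => // *; exact: bDl.
have bSr (c : 'I_n -> R) v : X v -> b v (\sum_i c i *: q_ i) = \sum_i c i * b v (q_ i).
  by move=> Xw; have [] := @lin_sum _ Y (b v) Y0 YD _ _ (index_enum _) c q_ Yq => // *; exact: bDr.
have lS (c : 'I_n -> R) : l (\sum_i c i *: q_ i) = \sum_i c i * l (q_ i).
  by have [] := @lin_sum _ Y l Y0 YD _ _ (index_enum _) c q_ Yq.
have [c Sc|x xS] := @row_solvable _ _ S r.
  pose u := \sum_i (usubmx c) i ord0 *: u_ i; pose p := \sum_i (dsubmx c) i ord0 *: q_ i.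
  move: Sc; rewrite -[c]vsubmxK /S mul_block_col mul0mx addr0 => /eqP.
  rewrite col_mx_eq0 => /andP[/eqP/matrixP Sc1 /eqP/matrixP Sc2].
  have lp : l p = 0.
    apply: (uniq u p); [exact: XS|exact: YS| |].
      move=> v Xv; have [k [ka _ kb]] := spanX Xv.
      rewrite ka ?kb; [|exact: YS|exact: XS].
      rewrite aSl ?bSl; [|exact: YS|exact: XS].
      rewrite -big_split big1//= => i _.
      rewrite -mulrDr (_ : _ + _ = 0) ?mulr0//.
      have := Sc1 i ord0; rewrite !mxE => <-; rewrite aSr ?bSr//.
      by congr (_ + _); apply: eq_bigr => j _; rewrite !mxE mulrC.
    move=> q Yq'; have [k [kb _]] := spanY Yq'.
    rewrite kb; last exact: XS.
    rewrite bSr; last exact: XS.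
    rewrite big1// => i _; rewrite (_ : b _ _ = 0) ?mulr0//.
    have := Sc2 i ord0; rewrite !mxE => <-; rewrite bSl//.
    by apply: eq_bigr => j _; rewrite !mxE mulrC.
  rewrite /r mul_row_col mul0mx add0r; apply/matrixP => i j.
  rewrite !ord1 [RHS]mxE mxE; apply: etrans lp; rewrite lS; apply: eq_bigr => k _.
  by rewrite !mxE mulrC.
pose u := \sum_i (lsubmx x) ord0 i *: u_ i; pose p := \sum_i (rsubmx x) ord0 i *: q_ i.
move: xS; rewrite -[x]hsubmxK /S mul_row_block mulmx0 addr0 => /eq_row_mx[/rowP x1 /rowP x2].
exists u, p; split; [exact: XS|exact: YS| |].
  move=> v Xv; have [k [_ ka kb]] := spanX Xv.
  rewrite ka ?kb; [|exact: YS|exact: XS].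
  rewrite aSr ?bSl; [|exact: YS|exact: XS].
  rewrite -big_split big1//= => j _.
  rewrite -mulrDr (_ : _ + _ = 0) ?mulr0//.
  have := x1 j; rewrite !mxE => <-; rewrite aSl ?bSr//.
  by congr (_ + _); apply: eq_bigr => i _; rewrite !mxE.
move=> q Yq'; have [k [kb kl]] := spanY Yq'.
rewrite kb ?kl; last exact: XS.
rewrite bSr ?lS; last exact: XS.
apply: eq_bigr => j _; congr (_ * _).
have := x2 j; rewrite !mxE => <-; rewrite bSl//.
by apply: eq_bigr => i _; rewrite !mxE.
Qed.
End saddle_point.

(** * Finite spanning families of the discrete spaces *)

Section finite_span.
Context {R : realType} {d : nat}.
Local Notation E := 'rV[R]_d.
Variables (D : set E).

(** Coefficient vectors with respect to the ambient family [e] live in a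
    finite-dimensional space, where those of members of [S] are spanned by finitely
    many of them. *)
Lemma finite_span_ae (W : lmodType R) (S : set (E -> W)) (J : finType) (e : J -> E -> W) :
  (forall v, S v -> exists c : J -> R, ae_on D (fun x => v x = \sum_j c j *: e j x)) ->
  exists k (s : 'I_k -> E -> W), (forall i, S (s i)) /\
    forall v, S v -> exists c : 'I_k -> R,
      ae_on D (fun x => v x = \sum_i c i *: s i x).
Proof.
move=> He.
pose comb (c : 'rV[R]_#|J|) x := \sum_j c ord0 (enum_rank j) *: e j x.
pose C : set 'rV[R]_#|J| := [set c | exists2 v, S v & ae_on D (fun x => v x = comb c x)].
have [k [M [CM spanM]]] := set_row_span C.
have CM' i : exists v, S v /\ ae_on D (fun x => v x = comb (row i M) x).
  by have [v Sv vE] := CM i; exists v.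
have [s sP] := choice CM'.
exists k, s; split => [i|v Sv]; first by have [] := sP i.
have [c cE] := He v Sv.
have /spanM/submxP[y yM] : C (\row_j c (enum_val j)).
  exists v => //; apply: ae_onS cE => x _ ->.
  by apply: eq_bigr => j _; rewrite mxE enum_rankK.
exists (fun i => y ord0 i).
have sE : ae_on D (fun x => forall i, i \in index_enum 'I_k -> s i x = comb (row i M) x).
  by apply: ae_on_seq => i _; have [] := sP i.
apply: ae_onS (ae_onI cE sE) => x _ [-> sx].
transitivity (comb (\row_j c (enum_val j)) x).
  by apply: eq_bigr => j _; rewrite mxE enum_rankK.
rewrite yM /comb; under eq_bigr do rewrite mxE scaler_suml.
rewrite exchange_big/=; apply: eq_bigr => i _; rewrite sx ?mem_index_enum// scaler_sumr.
by apply: eq_bigr => j _; rewrite mxE scalerA.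
Qed.

Variable M : {fset {fset E}}.
Hypothesis hM : conforming_mesh D M.
Local Notation conv := Defs.conv.

Lemma ae_on_conv (t : {fset E}) (P : E -> Prop) : ae_on (conv t) P ->
  ae_on D (fun x => conv t x -> P x).
Proof. by rewrite /ae_on; apply: filterS => x /= h _ cx; exact: h. Qed.

(** The index of a basis function is a simplex together with either a
    coordinate direction or the radial field. *)
Lemma RT0_finite_span : exists k (s : 'I_k -> E -> E), (forall i, RT0 D M (s i)) /\
  forall v, RT0 D M v -> exists c : 'I_k -> R,
    ae_on D (fun x => v x = \sum_i c i *: s i x).
Proof.
pose T (i : 'I_(size M)) : {fset E} := tnth (in_tuple M) i.
apply: (@finite_span_ae E (RT0 D M) (('I_(size M) * 'I_d) + 'I_(size M))%type
  (fun j x => match j with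
    | inl p => if x \in conv (T p.1) then delta_mx ord0 p.2 else 0
    | inr i => if x \in conv (T i) then x else 0 end)) => v [_ vaff].
have H t : exists ab : E * R, t \in M -> ae_on (conv t) (fun x => v x = ab.1 + ab.2 *: x).
  have [/vaff[a [b ab]]|tM] := boolP (t \in M); first by exists (a, b).
  by exists (0, 0).
have [ab abP] := choice H.
exists (fun j => match j with inl p => (ab (T p.1)).1 ord0 p.2 | inr i => (ab (T i)).2 end).
have := sum_mesh_ae (f := fun t x => (ab t).1 + (ab t).2 *: x) hM
  (fun t tM => ae_onS (fun x _ h cx => esym (h cx)) (ae_on_conv (abP t tM))).
apply: ae_onS => x _ <-.
rewrite big_sumType/= -(pair_bigA _ (fun i k => (ab (T i)).1 ord0 k *:
  (if x \in conv (T i) then delta_mx ord0 k else 0)))/= -big_split/=.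
rewrite (big_tnth _ _ (enum_fset M)); apply: eq_bigr => i _.
rewrite -/(T i); case: ifP => _; last first.
  by rewrite scaler0 addr0 big1// => k _; rewrite scaler0.
by congr (_ + _); rewrite [LHS]row_sum_delta.
Qed.

Lemma P0_finite_span : exists k (s : 'I_k -> E -> R^o), (forall i, P0 D M (s i)) /\
  forall v, P0 D M v -> exists c : 'I_k -> R,
    ae_on D (fun x => v x = \sum_i c i *: s i x).
Proof.
pose T (i : 'I_(size M)) : {fset E} := tnth (in_tuple M) i.
apply: (@finite_span_ae R^o (P0 D M) 'I_(size M)
  (fun i x => if x \in conv (T i) then 1 else 0)) => v [_ vc].
have H t : exists c : R, t \in M -> ae_on (conv t) (fun x => v x = c).
  have [/vc[c cP]|tM] := boolP (t \in M); first by exists c.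
  by exists 0.
have [c cP] := choice H.
exists (fun i => c (T i)).
have := sum_mesh_ae (f := fun t _ => c t) hM
  (fun t tM => ae_onS (fun x _ h cx => esym (h cx)) (ae_on_conv (cP t tM))).
apply: ae_onS => x _ <-.
rewrite (big_tnth _ _ (enum_fset M)); apply: eq_bigr => i _.
rewrite -/(T i); case: ifP => _; last by rewrite scaler0.
by rewrite /GRing.scale/= mulr1.
Qed.

End finite_span.

(** * The correctors *)

Section multiscale.
Context {R : realType} {d : nat}.
Local Notation E := 'rV[R]_d.
Local Notation leb := (lebesgue_rV d).
Local Notation conv := Defs.conv.
Variables (D : set E) (A : E -> 'M[R]_d) (alpha beta : R) (M : {fset {fset E}}).
Hypotheses (oD : open D) (bD : bounded_set D) (hD : polyhedral_boundary D).
Hypotheses (hA : admissible_coef D A alpha beta) (hM : conforming_mesh D M).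
Variables (K : set (E -> E)) (G : {fset E} -> (E -> E) -> (E -> E)).
Hypothesis hK : forall k, K k -> H0div D k /\ ae_on D (fun x => div D k x = 0).
Hypothesis hG : forall T, T \in M -> ideal_corrector D A K T (G T).

Let mD : measurable D. Proof. exact: open_measurable_rV. Qed.

Lemma H0div_inL2 v : H0div D v -> inLpv D 2%:E v.
Proof. by case=> -[]. Qed.

Definition cut (T : {fset E}) (u : E -> E) x := if x \in conv T then u x else 0.

Lemma cut_inL2 T u : inLpv D 2%:E u -> inLpv D 2%:E (cut T u).
Proof.
move=> Lu i.
rewrite (_ : (fun x => _) = (fun x => u x ord0 i) \_ (conv T)); last first.
  by apply/funext => x; rewrite patchE /cut; case: ifP => // _; rewrite mxE.
apply: (@inL2_dominated _ _ D mD _ (fun x => u x ord0 i) 1) => //.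
  apply/measurable_restrict => //; first exact: measurable_conv.
  exact: measurable_funS (inLp_measurable mD (Lu i)).
by apply: ae_onW => x _; rewrite mul1r patchE; case: ifP => // _; rewrite normr0.
Qed.

(** Cutting off the first argument turns the form over one simplex into the form
    over the whole domain, where bilinearity is available. *)
Lemma aform_conv T u w : T \in M -> aform A (conv T) u w = aform A D (cut T u) w.
Proof.
move=> TM; rewrite /aform /ipL2v (Rintegral_conv hM hD)//; apply: eq_Rintegral => x _.
rewrite patchE /cut; case: ifP => // _.
by rewrite /mxact mul0mx dotv0l.
Qed.

Lemma H0div_corr T v : T \in M -> H0div D v -> H0div D (G T v).
Proof. by move=> TM hv; have [/hK[]] := hG TM hv. Qed.

(** The difference [delta] of the two sides is a combination of three members of
    [K], and each of them is [a]-orthogonal to [delta]; so [a(delta, delta) = 0]. *)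
Lemma corr_lin T c u v w : T \in M -> H0div D u -> H0div D v -> H0div D w ->
  ae_on D (fun x => w x = c *: u x + v x) ->
  ae_on D (fun x => G T w x = c *: G T u x + G T v x).
Proof.
move=> TM hu hv hw wE.
have [Ku Gu] := hG TM hu; have [Kv Gv] := hG TM hv; have [Kw Gw] := hG TM hw.
have Lu := H0div_inL2 hu; have Lv := H0div_inL2 hv; have Lw := H0div_inL2 hw.
have Lgu := H0div_inL2 (H0div_corr TM hu).
have Lgv := H0div_inL2 (H0div_corr TM hv).
have Lgw := H0div_inL2 (H0div_corr TM hw).
pose z x := c *: G T u x + G T v x.
have Lz : inLpv D 2%:E z by exact: inL2v_lin.
pose delta x := -1 *: z x + G T w x.
have Ld : inLpv D 2%:E delta by exact: inL2v_lin.
have dK k : K k -> aform A D delta k = 0.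
  move=> Kk; have Lk : inLpv D 2%:E k by have [/H0div_inL2] := hK Kk.
  rewrite (aform_linl mD hA)// (aform_linl mD hA)// Gu// Gv// Gw// !aform_conv//.
  rewrite -(aform_linl mD hA)//; [|exact: cut_inL2|exact: cut_inL2].
  rewrite mulN1r addrC; apply/eqP; rewrite subr_eq0; apply/eqP.
  apply: (aform_ae mD hA) => //; [exact: cut_inL2| |].
    by apply: inL2v_lin => //; exact: cut_inL2.
  apply: ae_onS wE => x _ wx; rewrite /cut; case: ifP => // _.
  by rewrite scaler0 addr0.
have dd : aform A D delta delta = 0.
  rewrite {2}/delta (aform_linr mD hA)// (aform_linr mD hA)// !dK//.
  by rewrite mulr0 !addr0 mulr0.
apply: ae_onS (aform_eq0 mD hA Ld dd) => x _.
by rewrite /delta scaleN1r addrC => /subr0_eq.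
Qed.

Definition gsum (v : E -> E) x := \sum_(T <- M) G T v x.
Definition ms (v : E -> E) x := v x - gsum v x.

Lemma H0div0 v : H0div D v -> H0div D (fun=> 0).
Proof.
move=> hv; have := H0div_lin oD bD (-1) hv hv; congr (H0div D _).
by apply/funext => x; rewrite scaleN1r addNr.
Qed.

Lemma H0div_sum (s : seq {fset E}) v : {subset s <= M} -> H0div D v ->
  H0div D (fun x => \sum_(T <- s) G T v x).
Proof.
move=> + hv; elim: s => [_|T s IH sM].
  by under eq_fun do rewrite big_nil; exact: H0div0 hv.
have := H0div_lin oD bD 1 (H0div_corr (sM T (mem_head _ _)) hv)
  (IH (fun t ts => sM t (mem_behead (s := T :: s) ts))).
by congr (H0div D _); apply/funext => x; rewrite big_cons scale1r.
Qed.

Lemma H0div_gsum v : H0div D v -> H0div D (gsum v).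
Proof. by apply: H0div_sum => T. Qed.

Lemma H0div_ms v : H0div D v -> H0div D (ms v).
Proof.
move=> hv; have := H0div_lin oD bD (-1) (H0div_gsum hv) hv.
by congr (H0div D _); apply/funext => x; rewrite scaleN1r addrC.
Qed.

Lemma aform_gsuml v w : H0div D v -> inLpv D 2%:E w ->
  aform A D (gsum v) w = \sum_(T <- M) aform A D (G T v) w.
Proof.
move=> hv Lw.
suff H (s : seq {fset E}) : {subset s <= M} ->
    aform A D (fun x => \sum_(T <- s) G T v x) w = \sum_(T <- s) aform A D (G T v) w.
  by apply: H.
elim: s => [_|T s IH sM].
  rewrite big_nil; under eq_fun do rewrite big_nil.
  rewrite /aform /ipL2v; under eq_Rintegral do rewrite /mxact mul0mx dotv0l.
  by rewrite /Rintegral integral0.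
have sM' : {subset s <= M} by move=> t ts; apply: sM; rewrite inE ts orbT.
rewrite big_cons -IH// -[aform A D (G T v) w]mul1r -(aform_linl mD hA)//.
- by congr (aform A D _ w); apply/funext => x; rewrite big_cons scale1r.
- exact/H0div_inL2/H0div_corr/hv/sM/mem_head.
- exact/H0div_inL2/H0div_sum.
Qed.

Lemma aform_gsum v k : H0div D v -> K k -> aform A D (gsum v) k = aform A D v k.
Proof.
move=> hv Kk; have Lk : inLpv D 2%:E k by have [/H0div_inL2] := hK Kk.
have Lv := H0div_inL2 hv.
rewrite aform_gsuml// [RHS]/aform /ipL2v -(sum_Rintegral_mesh mD hM hD); last first.
  exact: (aform_integrable mD hA Lv Lk).
by apply: eq_big_seq => T TM; have [_ ->] := hG TM hv.
Qed.

(** Galerkin orthogonality, tested with the members [G T v] of [K] that add up to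
    [gsum v]. *)
Lemma aform_gsum_gsum v : H0div D v -> aform A D (gsum v) (gsum v) = aform A D v (gsum v).
Proof.
move=> hv; have Lv := H0div_inL2 hv; have Lg := H0div_inL2 (H0div_gsum hv).
rewrite [RHS](aform_sym mD hA)// !aform_gsuml//; apply: eq_big_seq => T TM.
have [KG _] := hG TM hv; have LG := H0div_inL2 (H0div_corr TM hv).
by rewrite (aform_sym mD hA)// aform_gsum// (aform_sym mD hA).
Qed.

(** Pythagoras: [a(v, v) = a(ms v, ms v) + a(gsum v, gsum v)]. *)
Lemma aform_ms_le v : H0div D v -> aform A D (ms v) (ms v) <= aform A D v v.
Proof.
move=> hv; have Lv := H0div_inL2 hv; have Lg := H0div_inL2 (H0div_gsum hv).
have msE : ms v = (fun x => -1 *: gsum v x + v x).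
  by apply/funext => x; rewrite scaleN1r addrC.
have Lm : inLpv D 2%:E (fun x => -1 *: gsum v x + v x) by exact: inL2v_lin.
rewrite msE (aform_linl mD hA)// !(aform_linr mD hA)//.
rewrite (aform_sym mD hA Lg Lv) -aform_gsum_gsum// !mulN1r opprD opprK.
have /andP[+ _] := aform_bounds mD hA Lg.
move=> /(le_trans _) h; have {h} := h 0.
rewrite mulr_ge0 ?ipL2v_ge0//; last exact/ltW/(alpha_gt0 hA).
by move=> /(_ isT) h; lra.
Qed.

Lemma ipL2v_ms_le v : H0div D v ->
  ipL2v D (ms v) (ms v) <= alpha^-1 * beta * ipL2v D v v.
Proof.
move=> hv; have a0 := alpha_gt0 hA.
rewrite -mulrA ler_pdivlMl//.
have /andP[h1 _] := aform_bounds mD hA (H0div_inL2 (H0div_ms hv)).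
have /andP[_ h2] := aform_bounds mD hA (H0div_inL2 hv).
exact: le_trans h1 (le_trans (aform_ms_le hv) h2).
Qed.

Lemma div_gsum v : H0div D v -> ae_on D (fun x => div D (gsum v) x = 0).
Proof.
move=> hv.
suff H (s : seq {fset E}) : {subset s <= M} ->
    ae_on D (fun x => div D (fun x => \sum_(T <- s) G T v x) x = 0).
  by apply: H => T.
elim: s => [_|T s IH sM].
  have h0 := H0div0 hv.
  have := div_lin oD bD (-1) h0.1 h0.1.
  rewrite (_ : (fun x => _ + _) = (fun=> 0)); last by apply/funext => x; rewrite scaler0 addr0.
  under [fun x : E => \sum_(_ <- _) _]eq_fun do rewrite big_nil.
  by apply: ae_onS => x _ ->; rewrite mulN1r addNr.
have sM' : {subset s <= M} by move=> t ts; apply: sM; rewrite inE ts orbT.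
have TM := sM T (mem_head _ _).
have [/hK[_ dG] _] := hG TM hv.
have := div_lin oD bD 1 (H0div_corr TM hv).1 (H0div_sum sM' hv).1.
rewrite (_ : (fun x => _ + _) = (fun x => \sum_(T <- T :: s) G T v x)); last first.
  by apply/funext => x; rewrite big_cons scale1r.
move=> h; apply: ae_onS (ae_onI h (ae_onI dG (IH sM'))) => x _ [-> [-> ->]].
by rewrite mulr0 addr0.
Qed.

Lemma div_ms v : H0div D v -> ae_on D (fun x => div D (ms v) x = div D v x).
Proof.
move=> hv; have := div_lin oD bD (-1) (H0div_gsum hv).1 hv.1.
rewrite (_ : (fun x => _ + _) = ms v); last first.
  by apply/funext => x; rewrite scaleN1r addrC.
move=> h; apply: ae_onS (ae_onI h (div_gsum hv)) => x _ [-> ->].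
by rewrite mulr0 add0r.
Qed.

Lemma bform_ms v q : H0div D v -> inLp D 2%:E q -> bform D (ms v) q = bform D v q.
Proof.
move=> hv Lq; apply: (ipL2_ae mD _ _ Lq (div_ms hv)); first exact: div_inL2 (H0div_ms hv).1.
exact: div_inL2 hv.1.
Qed.

End multiscale.

(** * Inf-sup stability of the multiscale space *)

Section stability.
Context {R : realType} {d : nat}.
Local Notation E := 'rV[R]_d.
Local Notation leb := (lebesgue_rV d).
Local Notation conv := Defs.conv.
Variables (D : set E) (A : E -> 'M[R]_d) (alpha beta : R) (M : {fset {fset E}}).
Hypotheses (oD : open D) (bD : bounded_set D) (hD : polyhedral_boundary D).
Hypotheses (hA : admissible_coef D A alpha beta) (hM : conforming_mesh D M).
Variables (K : set (E -> E)) (G : {fset E} -> (E -> E) -> (E -> E)).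
Hypothesis hK : forall k, K k -> H0div D k /\ ae_on D (fun x => div D k x = 0).
Hypothesis hG : forall T, T \in M -> ideal_corrector D A K T (G T).

Let mD : measurable D. Proof. exact: open_measurable_rV. Qed.

Local Notation X := (ideal_ms_space D M G).
Local Notation ms := (ms M G).
Local Notation gsum := (gsum M G).

Lemma zero_inL2 : inLp D 2%:E (fun=> 0 : R).
Proof.
apply: (@bounded_inL2 _ _ D oD bD _ 0); first exact: measurable_cst.
by move=> x _; rewrite normr0.
Qed.

Lemma H0div_zero : H0div D (fun=> 0).
Proof.
have L0 := zero_inL2.
have Lv0 : inLpv D 2%:E (fun=> 0).
  by move=> i; under eq_fun do rewrite mxE.
have z0 g : ipL2v D (fun=> 0) g = 0.
  rewrite /ipL2v; under eq_Rintegral do rewrite dotv0l.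
  by rewrite /Rintegral integral0.
have z0' g : ipL2 D (fun=> 0) g = 0.
  rewrite /ipL2; under eq_Rintegral do rewrite mul0r.
  by rewrite /Rintegral integral0.
have dv0 : is_div D (fun=> 0) (fun=> 0).
  by split=> // psi _; rewrite z0 z0' oppr0.
have H0 : Hdiv D (fun=> 0) by split=> //; exists (fun=> 0).
split=> // phi g [Lphi _ _]; rewrite z0 add0r.
rewrite (ipL2_ae mD _ L0 Lphi (is_div_unique oD bD (divP H0) dv0)) ?z0'//.
exact: div_inL2.
Qed.

Lemma RT0_lin c u v : RT0 D M u -> RT0 D M v -> RT0 D M (fun x => c *: u x + v x).
Proof.
move=> [hu pu] [hv pv]; split; first exact: H0div_lin.
move=> t tM; have [a [b ab]] := pu t tM; have [a' [b' ab']] := pv t tM.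
exists (c *: a + a'), (c * b + b').
move: ab ab'; rewrite /ae_on; apply: filterS2 => x /= h h' tx.
by rewrite h// h'// scalerDr scalerDl scalerA addrACA.
Qed.

Lemma RT0_zero : RT0 D M (fun=> 0).
Proof.
split; first exact: H0div_zero.
by move=> t tM; exists 0, 0; apply: aeW => x _; rewrite scale0r addr0.
Qed.

Lemma P0_lin (c : R) p q : P0 D M p -> P0 D M q -> P0 D M (fun x => c * p x + q x).
Proof.
move=> [[Lp p0] pp] [[Lq q0] pq]; split.
  split; first exact: inL2_lin.
  have ip := integrable_inL2 oD bD Lp; have iq := integrable_inL2 oD bD Lq.
  rewrite RintegralD//; last exact: (integrableZl mD c ip).
  by rewrite RintegralZl// p0 q0 mulr0 addr0.
move=> t tM; have [a ab] := pp t tM; have [a' ab'] := pq t tM.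
exists (c * a + a').
by move: ab ab'; rewrite /ae_on; apply: filterS2 => x /= h h' tx; rewrite h// h'.
Qed.

Lemma P0_zero : P0 D M (fun=> 0).
Proof.
split; first by split; [exact: zero_inL2|rewrite /Rintegral integral0].
by move=> t tM; exists 0; apply: aeW.
Qed.

Lemma ms_lin c u v w : H0div D u -> H0div D v -> H0div D w ->
  ae_on D (fun x => w x = c *: u x + v x) ->
  ae_on D (fun x => ms w x = c *: ms u x + ms v x).
Proof.
move=> hu hv hw wE.
have GE : ae_on D (fun x => forall T, T \in M -> G T w x = c *: G T u x + G T v x).
  apply: (@ae_on_seq _ _ _ _ (enum_fset M)
    (fun T x => G T w x = c *: G T u x + G T v x)) => T TM.
  by apply: (corr_lin oD hD hA hM hK hG TM).
apply: ae_onS (ae_onI wE GE) => x _ [wx Gx]; rewrite /ms /gsum wx.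
rewrite (eq_big_seq (fun T => c *: G T u x + G T v x))//.
by rewrite big_split/= -scaler_sumr scalerBr opprD addrACA.
Qed.

Lemma ms_inX v : RT0 D M v -> X (ms v).
Proof.
move=> rv; split; first exact: (H0div_ms oD bD hK hG rv.1).
by exists v => //; exact: ae_onW.
Qed.

Lemma X_lin c u v : X u -> X v -> X (fun x => c *: u x + v x).
Proof.
move=> [hu [u' ru uE]] [hv [v' rv vE]]; split; first exact: H0div_lin.
exists (fun x => c *: u' x + v' x); first exact: RT0_lin.
have := @ms_lin c u' v' _ ru.1 rv.1 (H0div_lin oD bD c ru.1 rv.1) (ae_onW (fun _ _ => erefl)).
move=> h; apply: ae_onS (ae_onI h (ae_onI uE vE)) => x _ [e [-> ->]].
exact: esym e.
Qed.

Lemma ms_zero : ae_on D (fun x => ms (fun=> 0) x = 0).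
Proof.
have h0 := H0div_zero.
have := @ms_lin (-1) _ _ _ h0 h0 h0.
rewrite (_ : (fun x : E => 0 = _) = (fun=> True)); last first.
  by apply/funext => x; rewrite scaler0 addr0 propeqE.
move=> /(_ (ae_onW (fun _ _ => Logic.I))).
by apply: ae_onS => x _; rewrite scaleN1r addNr.
Qed.

Lemma X_zero : X (fun=> 0).
Proof.
split; first exact: H0div_zero.
exists (fun=> 0); first exact: RT0_zero.
by apply: ae_onS ms_zero => x _ e; exact: esym e.
Qed.

Lemma ms_sum k (s : 'I_k -> E -> E) (c : 'I_k -> R) (r : seq 'I_k) :
  (forall i, RT0 D M (s i)) -> RT0 D M (fun x => \sum_(i <- r) c i *: s i x) /\
  ae_on D (fun x => ms (fun x => \sum_(i <- r) c i *: s i x) x =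
    \sum_(i <- r) c i *: ms (s i) x).
Proof.
move=> rs; elim: r => [|i r [IH1 IH2]].
  split; first by under eq_fun do rewrite big_nil; exact: RT0_zero.
  under [fun x : E => \sum_(_ <- _) _]eq_fun do rewrite big_nil.
  by apply: ae_onS ms_zero => x _ ->; rewrite big_nil.
have rir : RT0 D M (fun x => \sum_(i <- i :: r) c i *: s i x).
  by under eq_fun do rewrite big_cons; exact: RT0_lin.
split=> //.
have := @ms_lin (c i) _ _ _ (rs i).1 IH1.1 rir.1.
move=> /(_ (ae_onW (fun x _ => big_cons _ _ _ _ _ _))) h.
by apply: ae_onS (ae_onI h IH2) => x _ [-> ->]; rewrite big_cons.
Qed.

Lemma X_finite_span : exists k (s : 'I_k -> E -> E), (forall i, X (s i)) /\
  forall v, X v -> exists c : 'I_k -> R,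
    ae_on D (fun x => v x = \sum_i c i *: s i x).
Proof.
have [k [s [rs sspan]]] := RT0_finite_span hM.
exists k, (fun i => ms (s i)); split=> [i|u [hu [v rv uE]]]; first exact: ms_inX.
have [c cE] := sspan v rv; exists c.
have [r1 msE] := ms_sum c (index_enum _) rs.
have h0 := H0div_zero.
have := @ms_lin 1 _ _ _ r1.1 h0 rv.1.
have vE : ae_on D (fun x => v x = 1 *: (\sum_i c i *: s i x) + 0).
  by apply: ae_onS cE => x _ ->; rewrite scale1r addr0.
move=> /(_ vE) msv; apply: ae_onS (ae_onI (ae_onI uE msv) (ae_onI msE ms_zero)).
move=> x _ [[ux msvx] [<- m0]]; rewrite ux.
by move: msvx; rewrite scale1r m0 addr0 => <-.
Qed.

Lemma normV_sqr v : H0div D v ->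
  normV D v ^+ 2 = ipL2v D v v + ipL2 D (div D v) (div D v).
Proof.
move=> hv; have p1 := ipL2v_ge0 mD (H0div_inL2 hv); have p2 := ipL2_ge0 D (div D v).
rewrite /normV sqr_sqrtr ?addr_ge0 ?sqr_ge0//.
by rewrite /normL2v /normL2 !sqr_sqrtr.
Qed.

(** The divergence part of the norm is unchanged. The L2 part grows by at most
    [sqrt (beta / alpha)], and [t <= (1 + t) ^ 2] for [t = beta / alpha >= 1]. *)
Lemma normV_ms_le v : H0div D v -> normV D (ms v) <= (1 + alpha^-1 * beta) * normV D v.
Proof.
move=> hv; have a0 := alpha_gt0 hA.
have ab : 1 <= alpha^-1 * beta.
  by rewrite ler_pdivlMl// mulr1; case: hA => _ _ [].
have sqr_le (n1 n2 s1 s2 k : R) : 0 <= k -> 0 <= n1 -> 0 <= n2 ->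
    n1 ^+ 2 = s1 -> n2 ^+ 2 = s2 -> s1 <= k ^+ 2 * s2 -> n1 <= k * n2.
  move=> k0 n10 n20 <- <-; rewrite -exprMn ler_pXn2r ?nnegrE//.
  exact: mulr_ge0.
have hm := H0div_ms oD bD hK hG hv.
have h1 := ipL2v_ms_le oD bD hD hA hM hK hG hv.
have Ldm := div_inL2 hm.1; have Ldv := div_inL2 hv.1.
have dm := div_ms oD bD hK hG hv.
have e : ipL2 D (div D (ms v)) (div D (ms v)) = ipL2 D (div D v) (div D v).
  apply: etrans (ipL2_ae mD Ldm Ldv Ldm dm) _; apply: etrans (ipL2C D _ _) _.
  exact: (ipL2_ae mD Ldm Ldv Ldv dm).
have p1 := ipL2v_ge0 mD (H0div_inL2 hv); have p2 := ipL2_ge0 D (div D v).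
apply: (sqr_le _ _ _ _ _ _ (sqrtr_ge0 _) (sqrtr_ge0 _) (normV_sqr hm) (normV_sqr hv)).
  by apply: addr_ge0 => //; exact: le_trans ab.
move: e h1 p1 p2.
move: (ipL2v D (ms v) (ms v)) (ipL2v D v v) (ipL2 D (div D (ms v)) _)
  (ipL2 D (div D v) _) => x1 x2 y1 y2 -> h1 p1 p2.
rewrite mulrDr; apply: lerD; last by rewrite ler_peMl//; nra.
by apply: le_trans h1 _; apply: ler_wpM2r => //; nra.
Qed.

Lemma bform_normV0 v q : H0div D v -> inLp D 2%:E q -> normV D v = 0 -> bform D v q = 0.
Proof.
move=> hv Lq n0; have := normV_sqr hv; rewrite n0 expr0n/=.
have p1 := ipL2v_ge0 mD (H0div_inL2 hv); have p2 := ipL2_ge0 D (div D v).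
move=> e; have d0 : ipL2 D (div D v) (div D v) = 0 by lra.
rewrite /bform (ipL2_ae mD (div_inL2 hv.1) zero_inL2 Lq (ipL2_eq0 mD (div_inL2 hv.1) d0)).
rewrite /ipL2; under eq_Rintegral do rewrite mul0r.
by rewrite /Rintegral integral0.
Qed.

Lemma quotient_lt (b n n1 n2 k y : R) : 0 < k -> 0 < n -> 0 < n1 -> 0 < n2 -> 0 < b ->
  n2 <= k * n1 -> y * k < b / (n * n1) -> y < b / (n * n2).
Proof.
move=> k0 n0 n10 n20 b0 h hy.
apply: lt_le_trans (_ : b / (n * (k * n1)) <= _).
  rewrite ltr_pdivlMr ?mulr_gt0//; move: hy; rewrite ltr_pdivlMr ?mulr_gt0//.
  by congr (_ < _); ring.
by rewrite ler_pM2l// lef_pV2 ?posrE ?mulr_gt0// ler_pM2l.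
Qed.

(** Replacing [v] by [ms v] keeps [b(v, q)] and increases the norm by at most
    the factor [1 + beta / alpha]. *)
Lemma infsup_ms (gamma : R) : 0 < gamma ->
  (gamma%:E <= infsup D (RT0 D M) (P0 D M))%E ->
  ((gamma * (1 + alpha^-1 * beta)^-1)%:E <= infsup D X (P0 D M))%E.
Proof.
move=> g0 hg; have a0 := alpha_gt0 hA.
have b0 : 0 <= beta by case: hA => _ _ [_ ab] _; exact: le_trans (ltW a0) ab.
set kappa := 1 + _; have k0 : 0 < kappa.
  by rewrite ltr_pwDl// mulr_ge0// invr_ge0 ltW.
apply: le_ereal_inf_tmp => _ [q [Pq nq] <-]; rewrite leNgt; apply/negP => lt.
set SX := ereal_sup _ in lt.
have [y [SXy ylt]] : exists y : R, (SX <= y%:E)%E /\ y < gamma * kappa^-1.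
  case: SX lt => [r| |] //; first by rewrite lte_fin; exists r.
  by move=> _; exists 0; rewrite leNye divr_gt0.
pose y' := Num.max 0 y.
have y'lt : y' * kappa < gamma.
  by rewrite -ltr_pdivlMr// gt_max divr_gt0.
have : (gamma%:E <= ereal_sup [set (bform D v q / (normL2 D q * normV D v))%:E
        | v in [set v | RT0 D M v /\ normV D v != 0%R]])%E.
  by apply: le_trans hg _; apply: ge_ereal_inf; eexists; last exact: lexx; exists q.
have ylt' : ((y' * kappa)%:E < gamma%:E)%E by rewrite lte_fin.
move=> /(lt_le_trans ylt') /ereal_sup_gt[_ [v [rv nv] <-]]; rewrite lte_fin => h.
have hv := rv.1; have Lq := Pq.1.1.
have bE := bform_ms oD bD hK hG hv Lq.
have y'0 : 0 <= y' by rewrite le_max lexx.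
have nq0 : 0 < normL2 D q by rewrite lt0r nq; exact: sqrtr_ge0.
have nv0 : 0 < normV D v by rewrite lt0r nv; exact: sqrtr_ge0.
have bp : 0 < bform D v q.
  have yk0 : 0 <= y' * kappa by exact: mulr_ge0 y'0 (ltW k0).
  by move: (le_lt_trans yk0 h); rewrite pmulr_lgt0 ?invr_gt0 ?mulr_gt0.
have hm := H0div_ms oD bD hK hG hv.
have nm : normV D (ms v) != 0.
  apply: contraTneq bp => n0; rewrite -bE (bform_normV0 hm Lq n0).
  by rewrite ltxx.
have nm0 : 0 < normV D (ms v) by rewrite lt0r nm; exact: sqrtr_ge0.
have hy : ((bform D (ms v) q / (normL2 D q * normV D (ms v)))%:E <= y%:E)%E.
  apply: le_trans SXy; apply: ereal_sup_ubound; exists (ms v); last exact: erefl.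
  by split; [exact: ms_inX|exact: nm].
move: hy; rewrite bE lee_fin; apply/negP; rewrite -ltNge.
apply: le_lt_trans (_ : y <= y') _; first by rewrite le_max lexx orbT.
exact: (quotient_lt k0 nq0 nv0 nm0 bp (normV_ms_le hv) h).
Qed.

(** If [p] were not zero, all quotients for [q = p] would vanish and the infimum
    would be at most 0. *)
Lemma infsup_unique (Z : set (E -> E)) (c : R) p : 0 < c ->
  (c%:E <= infsup D Z (P0 D M))%E -> P0 D M p ->
  (forall v, Z v -> bform D v p = 0) -> ae_on D (fun x => p x = 0).
Proof.
move=> c0 hc Pp bp; apply: (ipL2_eq0 mD Pp.1.1).
have [n0|n0] := eqVneq (normL2 D p) 0.
  by rewrite -[LHS]sqr_sqrtr ?ipL2_ge0// -/(normL2 D p) n0 expr0n.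
have : (infsup D Z (P0 D M) <= 0)%E.
  apply: le_trans (_ : ereal_sup [set (bform D v p / (normL2 D p * normV D v))%:E
        | v in [set v | Z v /\ normV D v != 0%R]] <= _)%E.
    by apply: ge_ereal_inf; eexists; last exact: lexx; exists p.
  by apply: ge_ereal_sup => _ [v [Zv _] <-]; rewrite bp// mul0r.
by move=> /(le_trans hc); rewrite lee_fin leNgt c0.
Qed.

End stability.

(** * Well-posedness of the multiscale problem *)

Section well_posedness.
Context {R : realType} {d : nat}.
Local Notation E := 'rV[R]_d.
Variables (D : set E) (A : E -> 'M[R]_d) (alpha beta : R) (M : {fset {fset E}}).
Hypotheses (oD : open D) (bD : bounded_set D) (hD : polyhedral_boundary D).
Hypotheses (hA : admissible_coef D A alpha beta) (hM : conforming_mesh D M).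
Variables (K : set (E -> E)) (G : {fset E} -> (E -> E) -> (E -> E)).
Hypothesis hK : forall k, K k -> H0div D k /\ ae_on D (fun x => div D k x = 0).
Hypothesis hG : forall T, T \in M -> ideal_corrector D A K T (G T).
Variables (f : E -> R) (c : R).
Hypotheses (Lf : inLp D 2%:E f) (c0 : 0 < c).
Local Notation X := (ideal_ms_space D M G).
Hypothesis hc : (c%:E <= infsup D X (P0 D M))%E.

Let mD : measurable D. Proof. exact: open_measurable_rV. Qed.

Let XL2 u : X u -> inLpv D 2%:E u.
Proof. by move=> [/H0div_inL2]. Qed.

Let YL2 p : P0 D M p -> inLp D 2%:E p.
Proof. by move=> [[]]. Qed.

Lemma ipL2_0r g p : inLp D 2%:E g -> inLp D 2%:E p -> ae_on D (fun x => p x = 0) ->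
  ipL2 D g p = 0.
Proof.
move=> Lg Lp p0; rewrite ipL2C (ipL2_ae mD Lp (zero_inL2 oD bD) Lg p0).
rewrite /ipL2; under eq_Rintegral do rewrite mul0r.
by rewrite /Rintegral integral0.
Qed.

(** Testing the first equation with [u] itself gives [a(u, u) = 0], hence [u = 0];
    the inf-sup condition then gives [p = 0]. *)
Lemma ms_homogeneous u p : X u -> P0 D M p ->
  (forall v, X v -> aform A D u v + bform D v p = 0) ->
  (forall q, P0 D M q -> bform D u q = 0) ->
  ae_on D (fun x => u x = 0) /\ ae_on D (fun x => p x = 0).
Proof.
move=> Xu Pp h1 h2; have Lu := XL2 Xu.
have u0 : ae_on D (fun x => u x = 0).
  by apply: (aform_eq0 mD hA Lu); have := h1 u Xu; rewrite h2// addr0.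
split=> //; apply: (infsup_unique oD c0 hc Pp) => v Xv.
have := h1 v Xv; rewrite (aform_ae mD hA Lu _ (XL2 Xv) u0).
  rewrite /aform /ipL2v; under eq_Rintegral do rewrite /mxact mul0mx dotv0l.
  by rewrite /Rintegral integral0 add0r.
exact: H0div_inL2 (H0div_zero oD bD).
Qed.

(** The form [a] is symmetric, so the adjoint homogeneous system of
    [saddle_point_solvable] is the homogeneous system itself. *)
Lemma ms_well_posed : exists u p,
  ideal_ms_solution D A f X (P0 D M) u p /\
  forall u' p', ideal_ms_solution D A f X (P0 D M) u' p' ->
    ae_on D (fun x => u' x = u x) /\ ae_on D (fun x => p' x = p x).
Proof.
have [m [u_ [Xu spanX]]] := X_finite_span oD bD hD hA hM hK hG.
have [n [q_ [Yq spanY]]] := P0_finite_span hM.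
have Xlin k u v : X u -> X v -> X (k *: u + v).
  exact: (X_lin oD bD hD hA hM hK hG).
have Plin k (p q : E -> R^o) : P0 D M p -> P0 D M q -> P0 D M (k *: p + q).
  exact: (P0_lin oD bD).
have aDl k u v w : X u -> X v -> X w ->
    aform A D (k *: u + v) w = k * aform A D u w + aform A D v w.
  by move=> Xu' Xv Xw; exact: (aform_linl mD hA k (XL2 Xu') (XL2 Xv) (XL2 Xw)).
have aDr k u v w : X u -> X v -> X w ->
    aform A D w (k *: u + v) = k * aform A D w u + aform A D w v.
  by move=> Xu' Xv Xw; exact: (aform_linr mD hA k (XL2 Xu') (XL2 Xv) (XL2 Xw)).
have bDl k u v q : X u -> X v -> P0 D M q ->
    bform D (k *: u + v) q = k * bform D u q + bform D v q.
  by move=> [hu _] [hv _] Pq; exact: (bform_lin oD bD k hu hv (YL2 Pq)).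
have lD k (p q : E -> R^o) : P0 D M p -> P0 D M q ->
    - ipL2 D f (k *: p + q) = k * - ipL2 D f p + - ipL2 D f q.
  move=> Pp Pq; rewrite mulrN -opprD; congr (- _).
  rewrite ![ipL2 D f _]ipL2C.
  exact: (ipL2_lin mD k (YL2 Pp) (YL2 Pq) Lf).
have bDr k (p q : E -> R^o) v : X v -> P0 D M p -> P0 D M q ->
    bform D v (k *: p + q) = k * bform D v p + bform D v q.
  move=> [hv _] Pp Pq; rewrite /bform ![ipL2 D (div D v) _]ipL2C.
  exact: (ipL2_lin mD k (YL2 Pp) (YL2 Pq) (div_inL2 hv.1)).
have X0 := X_zero oD bD hD hA hM hK hG.
have Y0 := P0_zero M oD bD.
have XS (k : 'I_m -> R) : X (\sum_i k i *: u_ i).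
  have [] // := @lin_sum R (E -> E) X (fun=> 0) X0 Xlin _ _ (index_enum _) k u_ Xu.
  by move=> *; rewrite mulr0 addr0.
have YS (k : 'I_n -> R) : P0 D M (\sum_i k i *: q_ i).
  have [] // := @lin_sum R (E -> R^o) (P0 D M) (fun=> 0) Y0 Plin _ _ (index_enum _) k q_ Yq.
  by move=> *; rewrite mulr0 addr0.
have := @saddle_point_solvable R (E -> E) (E -> R^o) X (P0 D M)
  (aform A D) (bform D) (fun q => - ipL2 D f q) X0 Y0 Xlin Plin aDl aDr bDl bDr lD
  m n u_ q_ Xu Yq.
case.
- move=> v Xv; have [k kE] := spanX v Xv; exists k.
  have Xk := XS k.
  have kE' : ae_on D (fun x => v x = (\sum_i k i *: u_ i) x).
    by apply: ae_onS kE => x _ ->; rewrite fct_sumE.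
  split=> [w Xw|w Xw|q Pq].
  + exact: (aform_ae mD hA (XL2 Xv) (XL2 Xk) (XL2 Xw) kE').
  + rewrite (aform_sym mD hA (XL2 Xw) (XL2 Xv)) (aform_sym mD hA (XL2 Xw) (XL2 Xk)).
    exact: (aform_ae mD hA (XL2 Xv) (XL2 Xk) (XL2 Xw) kE').
  + exact: (bform_ae oD bD Xv.1 Xk.1 (YL2 Pq) kE').
- move=> q Pq; have [k kE] := spanY q Pq; exists k.
  have Pk := YS k.
  have kE' : ae_on D (fun x => q x = (\sum_i k i *: q_ i) x).
    by apply: ae_onS kE => x _ ->; rewrite fct_sumE.
  have H g : inLp D 2%:E g -> ipL2 D g q = ipL2 D g (\sum_i k i *: q_ i).
    move=> Lg; rewrite ipL2C [RHS]ipL2C.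
    exact: (ipL2_ae mD (YL2 Pq) (YL2 Pk) Lg kE').
  split=> [w [hw _]|]; last by rewrite (H _ Lf).
  exact: H (div_inL2 hw.1).
- move=> u p Xsu Psp h1 h2.
  have [_ p0] : ae_on D (fun x => u x = 0) /\ ae_on D (fun x => p x = 0).
    apply: (ms_homogeneous Xsu Psp _ h2) => v Xv.
    by rewrite (aform_sym mD hA (XL2 Xsu) (XL2 Xv)) h1.
  by rewrite (ipL2_0r Lf (YL2 Psp) p0) oppr0.
move=> u [p [Xsu Psp h1 h2]].
exists u, p; split=> [|u' p' [Xu' Pp' h1' h2']]; first by split.
have Xd := Xlin (-1) _ _ Xsu Xu'.
have Pd := Plin (-1) _ _ Psp Pp'.
have e1 v (Xv : X v) : aform A D (-1 *: u + u') v + bform D v (-1 *: p + p') = 0.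
  rewrite (aDl _ _ _ _ Xsu Xu' Xv) (bDr _ _ _ _ Xv Psp Pp') addrACA -mulrDr.
  by rewrite (h1 v Xv) (h1' v Xv) mulr0 addr0.
have e2 q (Pq : P0 D M q) : bform D (-1 *: u + u') q = 0.
  by rewrite (bDl _ _ _ _ Xsu Xu' Pq) (h2 q Pq) (h2' q Pq) mulN1r addNr.
have [w0 r0] := ms_homogeneous Xd Pd e1 e2.
split.
  apply: ae_onS w0 => x _ e; have : -1 *: u x + u' x = 0 := e.
  by rewrite scaleN1r addrC => /subr0_eq.
apply: ae_onS r0 => x _ e; have : -1 * p x + p' x = 0 := e.
by rewrite mulN1r addrC => /subr0_eq.
Qed.

End well_posedness.

Theorem lemma8 (R : realType) (d : nat) (hd : d = 2%N \/ d = 3%N)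
  (Omega : set 'rV[R]_d) (hOmega : polyhedral_lipschitz_domain Omega)
  (A : 'rV[R]_d -> 'M[R]_d) (alpha beta : R)
  (hA : admissible_coef Omega A alpha beta)
  (f : 'rV[R]_d -> R) (hf : spaceQ Omega f)
  (I : Type) (Th TH : I -> {fset {fset 'rV[R]_d}})
  (hmeshH : forall i, conforming_mesh Omega (TH i))
  (hmeshh : forall i, conforming_mesh Omega (Th i))
  (hrefine : forall i, clos_trans _ (refinement Omega) (TH i) (Th i))
  (hdisjoint : forall i, (Th i `&` TH i)%fset = fset0)
  (hregh : shape_regular Th) (hregH : shape_regular TH)
  (hquasi : quasi_uniform TH)
  (s : R) (hs : 2 < s)
  (Pih PiH : I -> ('rV[R]_d -> 'rV[R]_d) -> ('rV[R]_d -> 'rV[R]_d))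
  (hPih : forall i, RT_interpolation Omega s (Th i) (Pih i))
  (hPiH : forall i, RT_interpolation Omega s (TH i) (PiH i))
  (G : I -> {fset 'rV[R]_d} ->
    ('rV[R]_d -> 'rV[R]_d) -> ('rV[R]_d -> 'rV[R]_d))
  (hG : forall i T, T \in TH i ->
    ideal_corrector Omega A (Kfine Omega (Th i) (PiH i)) T (G i T))
  (CW COmega gamma : R) (hCW0 : 0 < CW) (hCOmega0 : 0 < COmega)
  (hCW : forall i v, spaceW Omega s v ->
    normV Omega (Pih i v) <= CW * normW Omega s v /\
    normV Omega (PiH i v) <= CW * normW Omega s v)
  (hCOmega : forall q, spaceQ Omega q -> exists w, [/\ spaceW Omega s w,
    ae_on Omega (fun x => div Omega w x = q x) &
    normW Omega s w <= COmega * normL2 Omega q])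
  (hgamma : gamma = CW^-1 * COmega^-1)
  (hinfsuph : forall i,
    (gamma%:E <= infsup Omega (RT0 Omega (Th i)) (P0 Omega (Th i)))%E)
  (hinfsupH : forall i,
    (gamma%:E <= infsup Omega (RT0 Omega (TH i)) (P0 Omega (TH i)))%E) :
  forall i,
    (exists u p,
      ideal_ms_solution Omega A f (ideal_ms_space Omega (TH i) (G i))
        (P0 Omega (TH i)) u p /\
      forall u' p',
        ideal_ms_solution Omega A f (ideal_ms_space Omega (TH i) (G i))
          (P0 Omega (TH i)) u' p' ->
        ae_on Omega (fun x => u' x = u x) /\
        ae_on Omega (fun x => p' x = p x)) /\
    ((gamma * (1 + alpha^-1 * beta)^-1)%:E <=
       infsup Omega (ideal_ms_space Omega (TH i) (G i)) (P0 Omega (TH i)))%E.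
Proof.
move=> i.
have [oO _ _ bO [_ pO]] := hOmega.
have hK k : Kfine Omega (Th i) (PiH i) k ->
    H0div Omega k /\ ae_on Omega (fun x => div Omega k x = 0) by case=> -[].
have g0 : 0 < gamma by rewrite hgamma mulr_gt0// invr_gt0.
have a0 := alpha_gt0 hA.
have b0 : 0 <= beta by case: hA => _ _ [_ ab] _; exact: le_trans (ltW a0) ab.
have stab := infsup_ms oO bO pO hA (hmeshH i) hK (@hG i) g0 (hinfsupH i).
split; last exact: stab.
apply: (ms_well_posed oO bO pO hA (hmeshH i) hK (@hG i) hf.1 _ stab).
by rewrite mulr_gt0// invr_gt0 ltr_pwDl// mulr_ge0// invr_ge0 ltW.
Qed.
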